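(* Let $X$ be a completely regular topological space and $C(X)$ the ring of all continuous real functions on $X$. The maximal ring of quotients $\mathcal{Q}(C(X))$ and the classical ring of quotients $\mathcal{Q}_{cl}(C(X))$ of $C(X)$ are the following subrings of $\mathbb{H}_{nf}(X)$: (a) $\mathcal{Q}(C(X))=\mathbb{H}_{nd}(X)=\{f\in\mathbb{H}_{nf}(X):\overline{W_f}\text{ is nowhere dense in }X\}$; (b) $\mathcal{Q}_{cl}(C(X))=\mathbb{H}_{sz}(X)=\{f\in\mathbb{H}_{nf}(X): W_f\text{ is a subset of a nowhere dense zero set of }X\}$.
   Context: Notation: $\overline{\mathbb{R}}=\mathbb{R}\cup\{\pm\infty\}$ and $\mathbb{I}\overline{\mathbb{R}}=\{[\underline{a},\overline{a}]:\underline{a},\overline{a}\in\overline{\mathbb{R}},\ \underline{a}\le\overline{a}\}$; $a\in\overline{\mathbb{R}}$ is identified with $[a,a]$. Width of $a=[\underline{a},\overline{a}]$: $w(a)=\overline{a}-\underline{a}$ if both endpoints are finite; $w(a)=+\infty$ if $\underline{a}<\overline{a}=+\infty$ or $\underline{a}=-\infty<\overline{a}$; $w(a)=0$ if $\underline{a}=\overline{a}=\pm\infty$. An interval function $f:X\to\mathbb{I}\overline{\mathbb{R}}$ is S-continuous if its graph $\{(x,y): x\in X,\ y\in f(x)\}$ is a closed subset of $X\times\overline{\mathbb{R}}$. For interval functions, $\varphi\subseteq f$ means $\varphi(x)\subseteq f(x)$ for all $x\in X$. An interval function $f$ is Hausdorff continuous (H-continuous) if it is S-continuous and minimal with respect to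 inclusion: whenever $\varphi:X\to\mathbb{I}\overline{\mathbb{R}}$ is S-continuous and $\varphi\subseteq f$, then $\varphi=f$. $\mathbb{H}(X)$ denotes the set of all H-continuous functions on $X$. For $f\in\mathbb{H}(X)$, $W_f=\{x\in X: w(f(x))>0\}$, and $\overline{W_f}$ is its closure in $X$. An H-continuous function $f$ is nearly finite if the set $\Gamma_f=\{x\in X: -\infty\in f(x)\text{ or }+\infty\in f(x)\}$ is closed and nowhere dense in $X$. $\mathbb{H}_{nf}(X)$ is the set of all nearly finite H-continuous functions on $X$; it contains $C(X)$ (real values being identified with point intervals). Interval arithmetic: for $A,B\in\mathbb{I}\overline{\mathbb{R}}$, $A+B=\{a+b:a\in A,b\in B\}$ and $A\times B=\{ab:a\in A,b\in B\}$, with the ambiguities at infinity resolved so as to guarantee inclusion: $-\infty+(+\infty)=[-\infty,+\infty]$, $0\times(+\infty)=[0,+\infty]$, $0\times(-\infty)=[-\infty,0]$. Point-wise operations: $(f+g)(x)=f(x)+g(x)$, $(f\times g)(x)=f(x)\times g(x)$. Ring operations: for $f,g\in\mathbb{H}_{nf}(X)$, each of $f+g$ and $f\times g$ is S-continuous and contains exactly one H-continuous function; $f\oplus g$ is the unique H-continuous function contained in $f+g$, and $f\otimes g$ is the unique H-continuous function contained in $f\times g$. With these operations $\mathbb{H}_{nf}(X)$ is a commutative ring with identity the constant $1$, containing $C(X)$ as a subring. A zero set of $X$ is a set of the form $Z(g)=\{x\in X: g(x)=0\}$ with $g\in C(X)$. Rings of quotients: let $B$ be a commutative ring with identity and $A$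 a subring with the same identity. $B$ is a rational extension (ring of quotients) of $A$ if for every $b\in B$ the set $b^{-1}A=\{a\in A: ba\in A\}$ is rationally dense in $B$, i.e. no nonzero element of $B$ annihilates $b^{-1}A$. $\mathcal{Q}(A)$ denotes the maximal rational extension of $A$ (also called the complete or total ring of quotients), which is determined up to isomorphism over $A$. $\mathcal{Q}_{cl}(A)=\{p/q: p,q\in A,\ q\text{ not a zero divisor}\}$ is the classical ring of quotients. In $\mathbb{H}_{nf}(X)$, a fraction $p/q$ with $p,q\in C(X)$, $q$ not a zero divisor, is understood as $p\otimes\frac1q$, where $\frac1q$ is the multiplicative inverse of $q$ in $\mathbb{H}_{nf}(X)$. The equalities with $\mathcal{Q}(C(X))$ and $\mathcal{Q}_{cl}(C(X))$ are understood as identifications over $C(X)$.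
   Formalization: f⊗g is the H-continuous function contained in the smallest S-continuous interval function containing f×g, since f×g itself may contain none (f(x)=x, g(x)=1/|x|, g(0)=+∞ on the reals); it agrees with the original product whenever that one exists. *)

(* Defs.v *)
From HB Require Import structures.
From mathcomp Require Import all_boot all_order all_algebra.
From mathcomp Require Import all_classical all_reals all_analysis.
From mathcomp Require Import ring lra.

Set Implicit Arguments.
Unset Strict Implicit.
Unset Printing Implicit Defensive.

Import Order.TTheory GRing.Theory Num.Theory.
Import numFieldNormedType.Exports.

Local Open Scope classical_set_scope.
Local Open Scope ring_scope.

Definition nowhere_dense (X : topologicalType) (A : set X) :=
  (closure A)^° = set0.

Section Intervals.
Context {R : realType}.
Local Open Scope ereal_scope.

Record ivl := Ivl { lo : \bar R; hi : \bar R; lo_le_hi : lo <= hi }.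

Definition iset (a : ivl) : set (\bar R) := [set y | lo a <= y <= hi a].

Definition ipt (y : \bar R) : ivl := Ivl (lexx y).

Definition width (a : ivl) : \bar R :=
  match lo a, hi a with
  | r%:E, s%:E => (s - r)%:E
  | l, h => if l == h then 0 else +oo
  end.

(* Set-valued operations on points: a +? b and a *? b exclude exactly the
   indeterminate forms -oo + (+oo) and 0 * (+oo), 0 * (-oo). *)
Definition eadd (a b : \bar R) : set (\bar R) :=
  if a +? b then [set a + b] else setT.

Definition emul (a b : \bar R) : set (\bar R) :=
  if a *? b then [set a * b]
  else if (a == +oo) || (b == +oo) then [set y | 0 <= y]
  else [set y | y <= 0].

Definition iadd (A B : ivl) : set (\bar R) :=
  \bigcup_(a in iset A) \bigcup_(b in iset B) eadd a b.

Definition imul (A B : ivl) : set (\bar R) :=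
  \bigcup_(a in iset A) \bigcup_(b in iset B) emul a b.

Lemma le_iopp (A : ivl) : - hi A <= - lo A.
Proof. by rewrite leeN2 lo_le_hi. Qed.

Definition iopp (A : ivl) : ivl := Ivl (le_iopp A).

Lemma ivl_eq (A B : ivl) : lo A = lo B -> hi A = hi B -> A = B.
Proof.
case: A B => [l h lh] [l' h' lh'] /= el eh; subst.
by congr Ivl; exact: bool_irrelevance.
Qed.

Lemma iset_lo A : iset A (lo A).
Proof. by rewrite /iset /= lexx lo_le_hi. Qed.

Lemma iset_hi A : iset A (hi A).
Proof. by rewrite /iset /= lexx lo_le_hi. Qed.

Lemma iset_sub A B : iset A `<=` iset B <-> lo B <= lo A /\ hi A <= hi B.
Proof.
split=> [AB|[l h] y /andP[ly yh]].
  have /andP[? ?] := AB _ (iset_lo A).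
  by have /andP[? ?] := AB _ (iset_hi A).
by rewrite /iset /= (le_trans l ly) (le_trans yh h).
Qed.

Lemma ioppK : involutive iopp.
Proof. by move=> A; apply: ivl_eq; rewrite /= oppeK. Qed.

Lemma iset_opp A y : iset (iopp A) y <-> iset A (- y).
Proof. by rewrite /iset /= leeNl andbC leeNr. Qed.

Lemma ereal_real_between (a b : \bar R) : a < b ->
  exists r : R, a < r%:E /\ r%:E < b.
Proof.
case: a b => [a| |] [b| |] //= ab.
- rewrite lte_fin in ab; exists ((a + b) / 2)%R.
  by rewrite !lte_fin midf_lt // midf_lt.
- by exists (a + 1)%R; rewrite lte_fin ltry; split => //; lra.
- by exists (b - 1)%R; rewrite lte_fin ltNyr; split => //; lra.
- by exists 0%R; rewrite ltry ltNyr.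
Qed.

Lemma le_ereal_dense (a b : \bar R) : (forall c, b < c -> a <= c) -> a <= b.
Proof.
move=> H; rewrite leNgt; apply/negP => /ereal_real_between[r [br ra]].
by have := H _ br; rewrite leNgt ra.
Qed.

End Intervals.
Arguments ivl : clear implicits.

Section IntervalFunctions.
Context {R : realType} {X : topologicalType}.
Implicit Types (f g h phi : X -> ivl R).
Local Open Scope ereal_scope.

Definition S_continuous f :=
  closed [set p : X * \bar R | iset (f p.1) p.2].

Definition subfun phi f := forall x, iset (phi x) `<=` iset (f x).

Definition H_continuous f :=
  S_continuous f /\ forall phi, S_continuous phi -> subfun phi f -> phi = f.

Definition W f : set X := [set x | 0 < width (f x)].

Definition Gamma f : set X := [set x | iset (f x) -oo \/ iset (f x) +oo].

Definition nearly_finite f := closed (Gamma f) /\ nowhere_dense (Gamma f).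

Definition fopp f := fun x => iopp (f x).

Lemma foppK f : fopp (fopp f) = f.
Proof. by apply/funext => x; rewrite /fopp ioppK. Qed.

Lemma fun_ivl_eq f g : (forall x, lo (f x) = lo (g x)) ->
  (forall x, hi (f x) = hi (g x)) -> f = g.
Proof. by move=> l h; apply/funext => x; exact: ivl_eq. Qed.

Lemma S_continuous_opp f : S_continuous f -> S_continuous (fopp f).
Proof.
move=> cf; rewrite /S_continuous.
rewrite [X in closed X](_ : _ =
  (fun p : X * \bar R => (p.1, - p.2)) @^-1`
    [set p : X * \bar R | iset (f p.1) p.2]); last first.
  by apply/seteqP; split=> [[x y]|[x y]] /= /iset_opp.
apply: preimage_closed cf => p _.
apply: cvg_pair; first exact: cvg_fst.
apply: (@continuous_comp _ _ _ (@snd X (\bar R)) (fun y => - y) p).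
  exact: cvg_snd.
exact: oppe_continuous.
Qed.

Lemma subfun_opp f g : subfun f g -> subfun (fopp f) (fopp g).
Proof. by move=> fg x y /iset_opp /fg /iset_opp. Qed.

Lemma H_continuous_opp f : H_continuous f -> H_continuous (fopp f).
Proof.
move=> [cf mf]; split; first exact: S_continuous_opp.
move=> phi cphi sphi; rewrite -(foppK phi); congr fopp.
apply: mf; first exact: S_continuous_opp.
by rewrite -(foppK f); exact: subfun_opp.
Qed.

Lemma S_continuous_hi f (x0 : X) (c : \bar R) : S_continuous f ->
  hi (f x0) < c -> \forall x \near x0, hi (f x) < c.
Proof.
move=> cf /ereal_real_between[r [hr rc]].
have nG (y : \bar R) : hi (f x0) < y ->
    nbhs (x0, y) [set p : X * \bar R | ~ iset (f p.1) p.2].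
  move=> hy; apply: open_nbhs_nbhs; split; first exact: closed_openC cf.
  by rewrite /= /iset /= => /andP[_]; rewrite leNgt hy.
have [[U V] /= [x0U [M [_ MV]]] UV] : nbhs (x0, +oo : \bar R)
    [set p : X * \bar R | ~ iset (f p.1) p.2].
  by apply: nG; apply: lt_trans hr _; rewrite ltry.
have /compact_near_coveringP cK := @segment_compact R r M.
have near_rM : \forall x \near x0, forall y : R,
    (r <= y <= M)%R -> ~ iset (f x) y%:E.
  suff : \forall x \near x0, `[r, M]%classic `<=` (fun y => ~ iset (f x) y%:E).
    by apply: filterS => x sub y ryM; apply: sub; rewrite /= in_itv.
  apply: (cK X (nbhs x0) (fun x y => ~ iset (f x) y%:E)) => y /=.
  rewrite in_itv /= => /andP[ry yM].
  have [[U' V'] /= [x0U' yV'] UV'] : nbhs (x0, y%:E)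
      [set p : X * \bar R | ~ iset (f p.1) p.2].
    by apply: nG; apply: lt_le_trans hr _; rewrite lee_fin.
  exists ((fun z : R => V' z%:E), U') => //= -[z x] /= [zV' xU'].
  exact: (UV' (x, z%:E)).
near=> x.
apply: le_lt_trans rc; rewrite leNgt; apply/negP => rhi.
have hin := @iset_hi _ (f x).
have xU : U x by near: x.
have [hM|/MV VM] := leP (hi (f x)) M%:E; last exact: (UV (x, hi (f x))).
have near_rMx : forall y : R, (r <= y <= M)%R -> ~ iset (f x) y%:E by near: x.
case E: (hi (f x)) hM rhi hin => [h| |] //; rewrite lee_fin lte_fin => hM rhi.
by apply: near_rMx; rewrite hM (ltW rhi).
Unshelve. all: by end_near. Qed.

Lemma S_continuous_lo f (x0 : X) (c : \bar R) : S_continuous f ->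
  c < lo (f x0) -> \forall x \near x0, c < lo (f x).
Proof.
move=> /S_continuous_opp cf; rewrite -lteN2 => /(S_continuous_hi cf) /=.
by apply: filterS => x; rewrite /= lteN2.
Qed.

Lemma S_continuousP f :
  (forall x0 c, hi (f x0) < c -> \forall x \near x0, hi (f x) < c) ->
  (forall x0 c, c < lo (f x0) -> \forall x \near x0, c < lo (f x)) ->
  S_continuous f.
Proof.
move=> uf lf; rewrite /S_continuous -openC openE => -[x0 y0] /= nin.
have [lt|ge] := ltP (hi (f x0)) y0.
  have [r [hr ry]] := ereal_real_between lt.
  exists ([set x | hi (f x) < r%:E], [set y | r%:E < y]).
    split=> /=; first exact: uf.
    by apply: open_nbhs_nbhs; split => //; exact: open_ereal_gt_ereal.
  by move=> [x y] /= [hx ryy] /andP[_]; rewrite leNgt (lt_trans hx ryy).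
have [lt|ge'] := ltP y0 (lo (f x0)).
  have [r [hr ry]] := ereal_real_between lt.
  exists ([set x | r%:E < lo (f x)], [set y | y < r%:E]).
    split=> /=; first exact: lf.
    by apply: open_nbhs_nbhs; split => //; exact: open_ereal_lt_ereal.
  by move=> [x y] /= [hx ryy] /andP[]; rewrite leNgt (lt_trans ryy hx).
by case: nin; rewrite /iset /= ge ge'.
Qed.

Lemma H_continuous_hi f (V : set X) (c : \bar R) : H_continuous f -> open V ->
  (forall x, V x -> lo (f x) <= c) -> forall x, V x -> hi (f x) <= c.
Proof.
move=> [cf mf] oV Vc x Vx.
have le y : lo (f y) <= if `[< V y >] then mine (hi (f y)) c else hi (f y).
  case: asboolP => [Vy|_]; last exact: lo_le_hi.
  by rewrite le_min lo_le_hi Vc.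
have <- : (fun y => Ivl (le y)) = f.
  apply: mf => [|y]; last first.
    apply/iset_sub => /=; split => //.
    by case: asboolP => // _; rewrite ge_min lexx.
  apply: S_continuousP => x0 d /= ; last exact: S_continuous_lo.
  case: asboolP => [Vx0|_] hd.
    have [hx0|] := ltP (hi (f x0)) d.
      near=> y; have : hi (f y) < d by near: y; exact: S_continuous_hi.
      by case: asboolP => // _; rewrite gt_min => ->.
    move=> dh; have cd : c < d.
      by move: hd; rewrite gt_min ltNge dh.
    near=> y; have Vy : V y by near: y; exact: open_nbhs_nbhs.
    by rewrite asboolT // gt_min cd orbT.
  near=> y; have : hi (f y) < d by near: y; exact: S_continuous_hi.
  by case: asboolP => // _; rewrite gt_min => ->.
by rewrite /= asboolT // ge_min lexx orbT.
Unshelve. all: by end_near. Qed.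

Lemma H_continuous_lo f (V : set X) (c : \bar R) : H_continuous f -> open V ->
  (forall x, V x -> c <= hi (f x)) -> forall x, V x -> c <= lo (f x).
Proof.
move=> /H_continuous_opp Hf oV Vc x Vx; rewrite -leeN2.
by apply: (H_continuous_hi Hf oV) Vx => y /Vc /=; rewrite leeN2.
Qed.

Definition usc_env (u : X -> \bar R) (x : X) :=
  ereal_inf [set c | \forall y \near x, u y <= c].

Definition lsc_env (u : X -> \bar R) (x : X) := - usc_env (fun y => - u y) x.

Lemma usc_env_ge u x : u x <= usc_env u x.
Proof. by apply: le_ereal_inf_tmp => c /nbhs_singleton. Qed.

Lemma usc_env_usc u x c : usc_env u x < c -> \forall y \near x, usc_env u y < c.
Proof.
move=> /ereal_inf_lt[d /= /nbhs_interior xd dc].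
apply: filterS xd => y yd; apply: le_lt_trans dc.
exact: ereal_inf_lbound.
Qed.

Lemma usc_env_le (u v : X -> \bar R) : (forall x, u x <= v x) ->
  (forall x c, v x < c -> \forall y \near x, v y < c) ->
  forall x, usc_env u x <= v x.
Proof.
move=> uv vc x; apply: le_ereal_dense => c /vc xc.
apply: ereal_inf_lbound; apply: filterS xc => y /ltW.
exact: le_trans.
Qed.

Lemma lsc_env_le u x : lsc_env u x <= u x.
Proof. by rewrite leeNl; exact: (usc_env_ge (fun y => - u y)). Qed.

Lemma lsc_env_lsc u x c : c < lsc_env u x -> \forall y \near x, c < lsc_env u y.
Proof.
rewrite lteNr => /usc_env_usc; apply: filterS => y.
by rewrite /lsc_env [c < - _]lteNr.
Qed.

Lemma lsc_env_ge (u v : X -> \bar R) : (forall x, v x <= u x) ->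
  (forall x c, c < v x -> \forall y \near x, c < v y) ->
  forall x, v x <= lsc_env u x.
Proof.
move=> vu vc x; rewrite leeNr.
apply: (@usc_env_le (fun y => - u y) (fun y => - v y)) => [y|y c].
  by rewrite leeN2.
by rewrite lteNl => /vc; apply: filterS => z; rewrite lteNl.
Qed.

Lemma ex_H_continuous phi : S_continuous phi ->
  exists2 h, H_continuous h & subfun h phi.
Proof.
move=> cphi; pose u := usc_env (fun x => lo (phi x)).
have lu x : lo (phi x) <= lsc_env u x.
  apply: (@lsc_env_ge u (fun x => lo (phi x))) => [y|y c]; first exact: (@usc_env_ge (fun x => lo (phi x))).
  exact: S_continuous_lo.
have uh x : u x <= hi (phi x).
  apply: (@usc_env_le _ (fun x => hi (phi x))) => [y|y c]; first exact: lo_le_hi.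
  exact: S_continuous_hi.
exists (fun x => Ivl (lsc_env_le u x)); last first.
  by move=> x; apply/iset_sub => /=; split; [exact: lu|exact: uh].
split=> [|psi cpsi spsi].
  by apply: S_continuousP => x c /=; [exact: usc_env_usc|exact: lsc_env_lsc].
have hpsi x : hi (psi x) = u x.
  have /iset_sub[/= l h] := spsi x; apply/eqP; rewrite eq_le h /=.
  apply: (@usc_env_le _ (fun x => hi (psi x))) => {x l h}[x|x c]; last exact: S_continuous_hi.
  have /iset_sub[/= l _] := spsi x.
  exact: le_trans (lu x) (le_trans l (lo_le_hi _)).
apply: fun_ivl_eq => x //=.
have /iset_sub[/= l h] := spsi x; apply/eqP; rewrite eq_le l andbT.
apply: (@lsc_env_ge u (fun x => lo (psi x))) => {x l h}[x|x c]; last exact: S_continuous_lo.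
by rewrite -hpsi lo_le_hi.
Qed.

(* The smallest S-continuous interval function containing a multifunction. *)
Lemma ex_hull (F : X -> set (\bar R)) : (forall x, F x !=set0) ->
  exists h, [/\ S_continuous h, forall x, F x `<=` iset (h x) &
    forall phi, S_continuous phi -> (forall x, F x `<=` iset (phi x)) ->
      subfun h phi].
Proof.
move=> F0; pose l := lsc_env (fun x => ereal_inf (F x)).
pose u := usc_env (fun x => ereal_sup (F x)).
have lF x y : F x y -> l x <= y.
  by move=> Fy; apply: le_trans (lsc_env_le _ _) _; exact: ereal_inf_lbound.
have Fu x y : F x y -> y <= u x.
  move=> Fy; apply: le_trans (usc_env_ge (fun x => ereal_sup (F x)) _).
  exact: ereal_sup_ubound.
have lu x : l x <= u x.
  by have [y Fy] := F0 x; apply: le_trans (lF _ _ Fy) (Fu _ _ Fy).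
exists (fun x => Ivl (lu x)); split.
- by apply: S_continuousP => x c /=; [exact: usc_env_usc|exact: lsc_env_lsc].
- by move=> x y Fy; rewrite /iset /= lF // Fu.
move=> phi cphi Fphi x; apply/iset_sub => /=; split.
  apply: (@lsc_env_ge _ (fun x => lo (phi x))) => [y|y c]; last exact: S_continuous_lo.
  by apply: le_ereal_inf_tmp => z /Fphi /andP[].
apply: (@usc_env_le _ (fun x => hi (phi x))) => [y|y c]; last exact: S_continuous_hi.
by apply: ge_ereal_sup => z /Fphi /andP[].
Qed.

End IntervalFunctions.

Section IntervalSum.
Context {R : realType}.
Local Open Scope ereal_scope.
Implicit Types A B : ivl R.

Lemma iaddP A B y a b : iset A a -> iset B b -> eadd a b y -> iadd A B y.
Proof. by move=> Aa Bb aby; exists a => //; exists b. Qed.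

Lemma iadd_itv A B y : lo A + lo B <= y -> y <= dual_adde (hi A) (hi B) ->
  iadd A B y.
Proof.
case: (boolP ((hi A == +oo) && (lo B == -oo))) => [/andP[/eqP hA /eqP lB] _ _|n1].
  apply: (@iaddP A B y +oo -oo); last by rewrite /eadd.
    by rewrite -hA; exact: iset_hi.
  by rewrite -lB; exact: iset_lo.
case: (boolP ((lo A == -oo) && (hi B == +oo))) => [/andP[/eqP hA /eqP lB] _ _|n2].
  apply: (@iaddP A B y -oo +oo); last by rewrite /eadd.
    by rewrite -hA; exact: iset_lo.
  by rewrite -lB; exact: iset_hi.
suff H : lo A + lo B <= y -> y <= dual_adde (hi A) (hi B) -> exists a b,
    [/\ iset A a, iset B b, a +? b & a + b = y].
  move=> /H /[apply] -[a [b [Aa Bb ab <-]]].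
  by apply: (iaddP Aa Bb); rewrite /eadd ab.
case: A B n1 n2 => [lA hA lhA] [lB hB lhB] /=.
rewrite /iset /=.
case: y => [y| |].
- move=> n1 n2 H1 H2.
  suff [r [r1 r2]] : exists r : R,
      lA <= r%:E <= hA /\ lB <= (y - r)%:E <= hB.
    by exists r%:E, (y - r)%:E; split=> //; rewrite -EFinD; congr EFin; ring.
  case: lA lhA H1 n2 => [lA| |] lhA H1 n2; case: hB lhB H2 n2 => [hB| |] lhB H2 n2 //.
  + exists (Num.max lA (y - hB)%R).
    case: hA lhA H2 n1 => [hA| |] // lhA H2 n1; case: lB lhB H1 n1 => [lB| |] // lhB H1 n1;
    case: (leP lA (y - hB)%R) => E;
    split; apply/andP; split; rewrite ?leey ?leNye -?EFinD ?lee_fin // in lhA lhB H1 H2 *; try lra.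
  + exists lA.
    case: hA lhA H2 n1 => [hA| |] // lhA H2 n1; case: lB lhB H1 n1 => [lB| |] // lhB H1 n1;
    split; apply/andP; split; rewrite ?leey ?leNye -?EFinD ?lee_fin // in lhA lhB H1 H2 *; try lra.
  + by case: hA lhA H2 n1; case: lB lhB H1 => [lB| |].
  + by case: hA lhA H2 n1 => [hA| |] // _ H2 n1; case: lB lhB H1 n1.
  + by case: hA lhA H2 n1 => [hA| |] // _ H2 n1; case: lB lhB H1 n1.
  + by case: hA lhA H2 n1 => [hA| |] // _ H2 n1; case: lB lhB H1 n1.
  + exists (y - hB)%R.
    case: hA lhA H2 n1 => [hA| |] // lhA H2 n1; case: lB lhB H1 n1 => [lB| |] // lhB H1 n1;
    split; apply/andP; split; rewrite ?leey ?leNye -?EFinD ?lee_fin // in lhA lhB H1 H2 *; try lra.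
  + by case: lB lhB H1 n1 => [lB| |] // lhB H1 n1; case: hA lhA H2 n1.
- move=> n1 n2 H1 H2.
  case: hA lhA H2 n1 n2 => [hA| |] lhA H2 n1 n2.
  + case: hB lhB H2 n2 => [hB| |] // lhB H2 n2.
    exists hA%:E, +oo; split => //; first by rewrite lhA lexx.
    by rewrite lhB lexx.
  + exists +oo, hB; split=> //; rewrite ?lhA ?lhB ?lexx //.
      by case: hB lhB {H1 H2 n2} => //; case: lB n1.
    by case: hB lhB {H1 H2 n2} => //; case: lB n1.
  + case: hB lhB H2 n2 => [hB| |] // lhB H2 n2.
    exists lA, +oo; split; rewrite ?lhA ?lhB ?lexx //.
      by case: lA lhA n2 {H1} => [lA| |].
    by case: lA lhA n2 {H1} => [lA| |].
- move=> n1 n2 H1 H2.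
  case: lA lhA H1 n1 n2 => [lA| |] lhA H1 n1 n2.
  + case: lB lhB H1 n1 => [lB| |] // lhB H1 n1.
    by exists lA%:E, -oo; split => //; rewrite lhA lexx.
  + case: hA lhA H2 n1 {n2} => [hA| |] // lhA H2 n1.
    by case: lB lhB H1 n1.
  + exists -oo, lB; split=> //; rewrite ?lhA ?lhB ?lexx //.
      by case: lB lhB {H1 H2 n1} => //; case: hB n2.
Qed.
End IntervalSum.

Section SumFunction.
Context {R : realType} {X : topologicalType}.
Local Open Scope ereal_scope.
Implicit Types f g : X -> ivl R.

Lemma dual_adde_lt (a b c : \bar R) : dual_adde a b < c ->
  exists r s : R, [/\ a < r%:E, b < s%:E & (r + s)%:E <= c].
Proof.
case: a b c => [a| |] [b| |] [c| |] //; rewrite ?lte_fin => H.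
- exists (a + (c - a - b) / 2)%R, (b + (c - a - b) / 2)%R.
  by rewrite !lte_fin lee_fin; split => //; lra.
- by move: H => _; exists (a + 1)%R, (b + 1)%R; rewrite !lte_fin leey; split => //; lra.
- by move: H => _; exists (a + 1)%R, (c - a - 1)%R; rewrite !lte_fin ltNyr lee_fin; split => //; lra.
- by move: H => _; exists (a + 1)%R, 0%R; rewrite !lte_fin ltNyr leey; split => //; lra.
- by move: H => _; exists (c - b - 1)%R, (b + 1)%R; rewrite !lte_fin ltNyr lee_fin; split => //; lra.
- by move: H => _; exists 0%R, (b + 1)%R; rewrite !lte_fin ltNyr leey; split => //; lra.
- by move: H => _; exists c, 0%R; rewrite !ltNyr lee_fin; split => //; lra.
- by exists 0%R, 0%R; rewrite !ltNyr leey.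
Qed.

Lemma le_fadd (A B : ivl R) : lo A + lo B <= dual_adde (hi A) (hi B).
Proof.
apply: (@le_trans _ _ (hi A + hi B)); first exact: leeD (lo_le_hi A) (lo_le_hi B).
by case: (hi A) (hi B) => [a| |] [b| |]; rewrite ?leey ?leNye.
Qed.

Definition fadd f g x := Ivl (le_fadd (f x) (g x)).

Lemma S_continuous_add f g :
  S_continuous f -> S_continuous g -> S_continuous (fadd f g).
Proof.
have H f' g' x0 c : S_continuous f' -> S_continuous g' ->
    hi (fadd f' g' x0) < c -> \forall x \near x0, hi (fadd f' g' x) < c.
  move=> cf cg /= /dual_adde_lt[r [s [hr hs rs]]].
  near=> x; apply: lt_le_trans rs.
  have : hi (f' x) < r%:E by near: x; exact: S_continuous_hi.
  have : hi (g' x) < s%:E by near: x; exact: S_continuous_hi.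
  by case: (hi (f' x)) => [a| |]; case: (hi (g' x)) => [b| |] //;
    move=> ha hb; (try exact: ltNyr); rewrite !lte_fin in ha hb *; lra.
move=> cf cg; apply: S_continuousP => x0 c; first exact: H.
have E x : lo (fadd f g x) = - hi (fadd (fopp f) (fopp g) x).
  by rewrite /= /dual_adde; case: (lo (f x)) (lo (g x)) => [a| |] [b| |] //=; congr EFin; ring.
rewrite E lteNr => /(H _ _ _ _ (S_continuous_opp cf) (S_continuous_opp cg)).
by apply: filterS => x; rewrite E lteNr.
Unshelve. all: by end_near. Qed.

Lemma fadd_sub f g x : iset (fadd f g x) `<=` iadd (f x) (g x).
Proof. by move=> y /andP[]; exact: iadd_itv. Qed.

Lemma sub_fadd f g x : iadd (f x) (g x) `<=` iset (fadd f g x).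
Proof.
move=> y [a /andP[la ah]] [b /andP[lb bh]]; rewrite /eadd /iset /=.
have L : lo (f x) + lo (g x) <= a + b by exact: leeD.
have L' : a + b <= dual_adde (hi (f x)) (hi (g x)).
  apply: (@le_trans _ _ (hi (f x) + hi (g x))); first exact: leeD.
  by case: (hi (f x)) (hi (g x)) => [? | |] [? | |]; rewrite ?leey ?leNye.
case: ifP => [_ -> | ]; first by rewrite L L'.
case: a b la ah lb bh {L L'} => [a| |] [b| |] // la ah lb bh _ _.
  move: la ah lb bh; rewrite !leye_eq !leeNy_eq => _ /eqP -> /eqP -> _.
  by rewrite addeNy leNye /= /dual_adde; case: (hi (g x)) => *; exact: leey.
move: la ah lb bh; rewrite !leye_eq !leeNy_eq => /eqP -> _ _ /eqP ->.
by rewrite addNye leNye /= /dual_adde; case: (hi (f x)) => *; exact: leey.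
Qed.
End SumFunction.

Section NowhereDense.
Context {X : topologicalType}.
Implicit Types A B U V : set X.

Lemma nowhere_denseP A : nowhere_dense A <->
  forall U, open U -> U !=set0 ->
    exists V, [/\ open V, V !=set0, V `<=` U & V `&` A = set0].
Proof.
split=> [dA U oU [x Ux]|H].
  exists (U `&` ~` closure A); split; last first.
  - by apply/seteqP; split=> // y [[_ nA] /subset_closure /nA].
  - by move=> y [].
  - apply: contrapT => /set0P/negP/negPn/eqP E.
    have : (closure A)^° x.
      apply: filterS (open_nbhs_nbhs (conj oU Ux)) => y Uy.
      by apply: contrapT => nA; have : set0 y by rewrite -E.
    by rewrite dA.
  - by apply: openI => //; exact/closed_openC/closed_closure.
apply/seteqP; split=> // x xA.
have [V [oV [y Vy] Vi VA]] := H _ (@open_interior _ (closure A)) (ex_intro _ x xA).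
have [z [Az Vz]] := interior_subset (Vi _ Vy) _ (open_nbhs_nbhs (conj oV Vy)).
by have : (V `&` A) z by []; rewrite VA.
Qed.

Lemma nowhere_denseS A B : A `<=` B -> nowhere_dense B -> nowhere_dense A.
Proof.
move=> AB dB; apply/seteqP; split=> // x /(interiorS (closureS AB)).
by rewrite dB.
Qed.

Lemma nowhere_denseU A B :
  nowhere_dense A -> nowhere_dense B -> nowhere_dense (A `|` B).
Proof.
move=> /nowhere_denseP dA /nowhere_denseP dB; apply/nowhere_denseP => U oU U0.
have [V [oV V0 VU VA]] := dA U oU U0.
have [V' [oV' V'0 V'V V'B]] := dB V oV V0.
exists V'; split=> //; first exact: subset_trans VU.
apply/seteqP; split=> // x [V'x [Ax|Bx]].
  by rewrite -VA; split => //; exact: V'V.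
by rewrite -V'B.
Qed.

Lemma nowhere_dense_closure A : nowhere_dense A -> nowhere_dense (closure A).
Proof. by rewrite /nowhere_dense -(closure_id (closure A)).1 //; exact: closed_closure. Qed.

Lemma nowhere_dense0 : nowhere_dense (set0 : set X).
Proof. by rewrite /nowhere_dense closure0 interior0. Qed.

End NowhereDense.


Section NearlyFinite.
Context (R : realType) (X : topologicalType).

Record Hnf := MkHnf {
  Hnf_fun :> X -> ivl R;
  Hnf_H : H_continuous Hnf_fun;
  Hnf_nearly_finite : nearly_finite Hnf_fun }.

Lemma Hnf_eq (f g : Hnf) : (f : X -> ivl R) = g -> f = g.
Proof.
case: f g => [f Hf nf] [g Hg ng] /= E; subst g.
by congr MkHnf; exact: Prop_irrelevance.
Qed.

HB.instance Definition _ := gen_eqMixin Hnf.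
HB.instance Definition _ := gen_choiceMixin Hnf.

Implicit Types f g h : Hnf.

Lemma Hnf_S f : S_continuous f.
Proof. by have [] := Hnf_H f. Qed.

Lemma closed_Gamma (f : X -> ivl R) : S_continuous f -> closed (Gamma f).
Proof.
move=> cf; rewrite -openC openE => x /= nG.
have hx : (hi (f x) < +oo)%E.
  rewrite ltey; apply/eqP => E; apply: nG; right.
  by rewrite -E; exact: iset_hi.
have lx : (-oo < lo (f x))%E.
  rewrite ltNye; apply/eqP => E; apply: nG; left.
  by rewrite -E; exact: iset_lo.
near=> y.
have hy : (hi (f y) < +oo)%E by near: y; exact: S_continuous_hi.
have ly : (-oo < lo (f y))%E by near: y; exact: S_continuous_lo.
move=> [] /andP[l h].
  by move: (lt_le_trans ly l); rewrite ltxx.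
by move: (le_lt_trans h hy); rewrite ltxx.
Unshelve. all: by end_near. Qed.

Definition approx (f : X -> ivl R) (V : set X) (c e : R) :=
  forall x, V x -> ((c - e)%:E <= lo (f x))%E /\ (hi (f x) <= (c + e)%:E)%E.

Lemma approxW (f : X -> ivl R) V c e e' : e <= e' ->
  approx f V c e -> approx f V c e'.
Proof.
move=> ee' H x /H[l h]; split.
  by apply: le_trans l; rewrite lee_fin; lra.
by apply: le_trans h _; rewrite lee_fin; lra.
Qed.

Lemma approxS (f : X -> ivl R) V V' c e : V' `<=` V ->
  approx f V c e -> approx f V' c e.
Proof. by move=> sV H x /sV; exact: H. Qed.

Lemma approx_sub (f g : X -> ivl R) V c e : subfun f g ->
  approx g V c e -> approx f V c e.
Proof.
move=> fg H x /H[l h]; have /iset_sub[l' h'] := fg x.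
by split; [exact: le_trans l l'|exact: le_trans h' h].
Qed.

Lemma approx_in (f : X -> ivl R) V c e x y : approx f V c e -> V x ->
  iset (f x) y -> exists2 r : R, y = r%:E & c - e <= r <= c + e.
Proof.
move=> H /H[l h] /andP[l' h'].
have {l l'}l := le_trans l l'; have {h h'}h := le_trans h' h.
case: y l h => [r| |] //; rewrite !lee_fin => l h.
by exists r => //; rewrite l h.
Qed.

Lemma approx_Gamma (f : X -> ivl R) V c e : approx f V c e ->
  V `&` Gamma f = set0.
Proof.
by move=> H; apply/seteqP; split => // x [Vx] [] /(approx_in H Vx)[].
Qed.

Lemma osc f (U : set X) (e : R) : open U -> U !=set0 -> 0 < e ->
  exists V c, [/\ open V, V !=set0, V `<=` U & approx f V c e].
Proof.
move=> oU U0 e0.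
have [V [oV [x Vx] VU VG]] := (nowhere_denseP _).1 (Hnf_nearly_finite f).2 U oU U0.
have nG : ~ Gamma f x by move=> Gx; have : (V `&` Gamma f) x by []; rewrite VG.
have [c Ec] : exists c : R, hi (f x) = c%:E.
  have := @iset_hi _ (f x); case: (hi (f x)) => [c| |]; first by exists c.
    by move=> H; case: nG; right.
  by move=> H; case: nG; left.
pose V1 := V `&` (fun y => hi (f y) < (c + e)%:E)%E^°.
have oV1 : open V1 by apply: openI => //; exact: open_interior.
have V1x : V1 x.
  split=> //; apply: S_continuous_hi; first exact: Hnf_S.
  by rewrite Ec lte_fin; lra.
have [y [V1y ly]] : exists y, V1 y /\ ((c - e)%:E < lo (f y))%E.
  apply: contrapT => H.
  have := H_continuous_hi (c := (c - e)%:E) (Hnf_H f) oV1 _ V1x.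
  rewrite Ec lee_fin => H'; suff : c <= c - e by lra.
  apply: H' => y V1y; rewrite leNgt; apply/negP => ly.
  by apply: H; exists y.
exists (V1 `&` (fun y => (c - e)%:E < lo (f y))%E^°), c; split.
- by apply: openI => //; exact: open_interior.
- by exists y; split => //; apply: S_continuous_lo => //; exact: Hnf_S.
- by move=> z [[/VU]].
move=> z [[_ /interior_subset hz] /interior_subset lz].
by split; exact: ltW.
Qed.

Lemma nearly_finite_sub (h phi : X -> ivl R) : S_continuous h ->
  subfun h phi -> nowhere_dense (Gamma phi) -> nearly_finite h.
Proof.
move=> ch hphi dphi; split; first exact: closed_Gamma.
by apply: nowhere_denseS dphi => x [] /hphi; [left|right].
Qed.

Lemma ex_Hnf (phi : X -> ivl R) : S_continuous phi ->
  nowhere_dense (Gamma phi) -> exists h : Hnf, subfun h phi.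
Proof.
move=> cphi dphi; have [h Hh hphi] := ex_H_continuous cphi.
by exists (MkHnf Hh (nearly_finite_sub (proj1 Hh) hphi dphi)).
Qed.

(* Two nearly finite H-continuous functions agree as soon as they are
   arbitrarily close on some nonempty open part of every open set. *)
Lemma Hnf_eq_approx f g :
  (forall U (e : R), open U -> U !=set0 -> 0 < e -> exists V c,
    [/\ open V, V !=set0, V `<=` U & approx f V c e /\ approx g V c e]) ->
  f = g.
Proof.
have Hle f' g' : (forall U (e : R), open U -> U !=set0 -> 0 < e -> exists V c,
    [/\ open V, V !=set0, V `<=` U & approx f' V c e /\ approx g' V c e]) ->
    forall x, (hi (f' x) <= hi (g' x))%E.
  move=> H x; rewrite leNgt; apply/negP => gf.
  have [a [ga af]] := ereal_real_between gf.
  have [b [ab bf]] := ereal_real_between af; rewrite lte_fin in ab.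
  pose U := (fun y => hi (g' y) < a%:E)%E^°.
  have Ux : U x by apply: S_continuous_hi ga; exact: Hnf_S.
  have oU : open U by exact: open_interior.
  have [y [Uy by_]] : exists y, U y /\ (b%:E < lo (f' y))%E.
    apply: contrapT => N.
    have := H_continuous_hi (c := b%:E) (Hnf_H f') oU _ Ux.
    rewrite leNgt bf => /(_ _)/negP; case => //= y Uy.
    by rewrite leNgt; apply/negP => ?; apply: N; exists y.
  pose U' := U `&` (fun y => b%:E < lo (f' y))%E^°.
  have U'y : U' y by split => //; apply: S_continuous_lo by_; exact: Hnf_S.
  have oU' : open U' by apply: openI => //; exact: open_interior.
  have e0 : 0 < (b - a) / 2 by lra.
  have [V [c [oV [z Vz] VU [af' ag']]]] := H U' _ oU' (ex_intro _ y U'y) e0.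
  have [/interior_subset /= gz /interior_subset /= fz] := VU _ Vz.
  have [_ H1] := af' _ Vz; have [H2 _] := ag' _ Vz.
  have := lt_le_trans fz (le_trans (lo_le_hi _) H1).
  have := le_lt_trans (le_trans H2 (lo_le_hi _)) gz.
  by rewrite !lte_fin; lra.
have Hge f' g' : (forall U (e : R), open U -> U !=set0 -> 0 < e -> exists V c,
    [/\ open V, V !=set0, V `<=` U & approx f' V c e /\ approx g' V c e]) ->
    forall x, (lo (f' x) <= lo (g' x))%E.
  move=> H x; rewrite leNgt; apply/negP => gf.
  have [a [ga af]] := ereal_real_between gf.
  have [b [ab bf]] := ereal_real_between af; rewrite lte_fin in ab.
  pose U := (fun y => b%:E < lo (f' y))%E^°.
  have Ux : U x by apply: S_continuous_lo bf; exact: Hnf_S.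
  have oU : open U by exact: open_interior.
  have [y [Uy by_]] : exists y, U y /\ (hi (g' y) < a%:E)%E.
    apply: contrapT => N.
    have := H_continuous_lo (c := a%:E) (Hnf_H g') oU _ Ux.
    rewrite leNgt ga => /(_ _)/negP; case => //= y Uy.
    by rewrite leNgt; apply/negP => ?; apply: N; exists y.
  pose U' := U `&` (fun y => hi (g' y) < a%:E)%E^°.
  have U'y : U' y by split => //; apply: S_continuous_hi by_; exact: Hnf_S.
  have oU' : open U' by apply: openI => //; exact: open_interior.
  have e0 : 0 < (b - a) / 2 by lra.
  have [V [c [oV [z Vz] VU [af' ag']]]] := H U' _ oU' (ex_intro _ y U'y) e0.
  have [/interior_subset /= fz /interior_subset /= gz] := VU _ Vz.
  have [_ H1] := af' _ Vz; have [H2 _] := ag' _ Vz.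
  have := lt_le_trans fz (le_trans (lo_le_hi _) H1).
  have := le_lt_trans (le_trans H2 (lo_le_hi _)) gz.
  by rewrite !lte_fin; lra.
move=> H.
have H' U (e : R) : open U -> U !=set0 -> 0 < e -> exists V c,
    [/\ open V, V !=set0, V `<=` U & approx g V c e /\ approx f V c e].
  move=> oU U0 e0; have [V [c [? ? ? []]]] := H U e oU U0 e0.
  by exists V, c.
apply/Hnf_eq/fun_ivl_eq => x; apply/eqP.
  by rewrite eq_le (Hge _ _ H) (Hge _ _ H').
by rewrite eq_le (Hle _ _ H) (Hle _ _ H').
Qed.

End NearlyFinite.


Section ContinuousRing.
Context (R : realType) (X : topologicalType).
Local Notation C := (continuousType X R).
Implicit Types p q : C.

Definition cts_zero : C := cst 0.
Definition cts_one : C := cst 1.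
Lemma cts_opp_subproof p : continuous (fun x => - p x).
Proof. by move=> x; apply: continuousN; exact: cts_fun. Qed.
Lemma cts_add_subproof p q : continuous (fun x => p x + q x).
Proof. by move=> x; apply: continuousD; exact: cts_fun. Qed.
Lemma cts_mul_subproof p q : continuous (fun x => p x * q x).
Proof. by move=> x; apply: continuousM; exact: cts_fun. Qed.
Definition cts_opp p : C := mkcts (@cts_opp_subproof p).
Definition cts_add p q : C := mkcts (@cts_add_subproof p q).
Definition cts_mul p q : C := mkcts (@cts_mul_subproof p q).

Lemma cts_addA : associative cts_add.
Proof. by move=> p q r; apply/continuousEP => x /=; exact: addrA. Qed.
Lemma cts_addC : commutative cts_add.
Proof. by move=> p q; apply/continuousEP => x /=; exact: addrC. Qed.
Lemma cts_add0 : left_id cts_zero cts_add.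
Proof. by move=> p; apply/continuousEP => x /=; exact: add0r. Qed.
Lemma cts_addN : left_inverse cts_zero cts_opp cts_add.
Proof. by move=> p; apply/continuousEP => x /=; exact: addNr. Qed.
HB.instance Definition _ :=
  GRing.isZmodule.Build C cts_addA cts_addC cts_add0 cts_addN.

Lemma cts_mulA : associative cts_mul.
Proof. by move=> p q r; apply/continuousEP => x /=; exact: mulrA. Qed.
Lemma cts_mulC : commutative cts_mul.
Proof. by move=> p q; apply/continuousEP => x /=; exact: mulrC. Qed.
Lemma cts_mul1 : left_id cts_one cts_mul.
Proof. by move=> p; apply/continuousEP => x /=; exact: mul1r. Qed.
Lemma cts_mulDl : left_distributive cts_mul cts_add.
Proof. by move=> p q r; apply/continuousEP => x /=; exact: mulrDl. Qed.
HB.instance Definition _ :=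
  GRing.Zmodule_isComPzRing.Build C cts_mulA cts_mulC cts_mul1 cts_mulDl.

End ContinuousRing.

Section HnfRing.
Context (R : realType) (X : topologicalType).
Local Notation C := (continuousType X R).
Local Notation H := (Hnf R X).
Implicit Types (f g h u v : H) (p q : C).

(* A real continuous function as a point-valued interval function. *)
Definition fpt p : X -> ivl R := fun x => ipt (p x)%:E.

Lemma fpt_S p : S_continuous (fpt p).
Proof.
have cp x0 (A : set (\bar R)) :
    nbhs (p x0)%:E A -> \forall x \near x0, A (p x)%:E.
  by move=> ?; exact: (@cts_fun _ _ p x0 (fun r => A r%:E)).
apply: S_continuousP => x0 c /= hc.
  apply: (cp x0 (fun y => y < c)%E).
  by apply: open_nbhs_nbhs; split => //; exact: open_ereal_lt_ereal.
apply: (cp x0 (fun y => c < y)%E).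
by apply: open_nbhs_nbhs; split => //; exact: open_ereal_gt_ereal.
Qed.

Lemma fpt_H p : H_continuous (fpt p).
Proof.
split=> [|phi _ sphi]; first exact: fpt_S.
apply: fun_ivl_eq => x; have /iset_sub[/= l h] := sphi x; apply/eqP.
  by rewrite eq_le l andbT; exact: le_trans (lo_le_hi _) h.
by rewrite eq_le h /=; exact: le_trans l (lo_le_hi _).
Qed.

Lemma fpt_nf p : nearly_finite (fpt p).
Proof.
have -> : nearly_finite (fpt p) <-> True.
  rewrite /nearly_finite (_ : Gamma (fpt p) = set0).
    by split => // _; split; [exact: closed0|exact: nowhere_dense0].
  apply/seteqP; split=> // x; rewrite /Gamma /iset /= => -[] // /andP[_].
  by rewrite leye_eq.
by [].
Qed.

Definition inc p : H := MkHnf (fpt_H p) (fpt_nf p).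

Lemma fopp_nf f : nearly_finite (fopp f).
Proof.
rewrite /nearly_finite (_ : Gamma (fopp f) = Gamma f).
  exact: Hnf_nearly_finite.
by apply/seteqP; split=> x [] /=; rewrite /Gamma /=;
  [move=> /iset_opp; right|move=> /iset_opp; left| right; apply/iset_opp |
   left; apply/iset_opp].
Qed.

Definition hopp f : H := MkHnf (H_continuous_opp (Hnf_H f)) (@fopp_nf f).

Definition hadd f g : H :=
  xget (inc 0) [set h : H | forall x, iset (h x) `<=` iadd (f x) (g x)].

(* h is contained in the smallest S-continuous interval function containing
   f * g. This is containment in f * g itself whenever f * g is an S-continuous
   interval function. With 0 * (+oo) = [0, +oo] this may fail: for f x = x and
   g x = 1 / `|x| (g 0 = +oo) the graph of f * g accumulates at (0, -1), but
   -1 is not in (f * g)(0) = [0, +oo]. The H-continuous functions contained in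
   f * g are in any case equal to hmul f g, see hmul_unique_sub. *)
Definition sub_mul_hull f g (h : X -> ivl R) :=
  forall phi : X -> ivl R, S_continuous phi ->
    (forall x, imul (f x) (g x) `<=` iset (phi x)) -> subfun h phi.

Definition hmul f g : H := xget (inc 0) [set h : H | sub_mul_hull f g h].

Lemma approx_add f g V a b d : approx f V a d -> approx g V b d ->
  approx (fadd f g) V (a + b) (2 * d).
Proof.
move=> Hf Hg x Vx; have [lf hf] := Hf x Vx; have [lg hg] := Hg x Vx.
split=> /=.
  apply: le_trans (leeD lf lg); rewrite -EFinD lee_fin; lra.
have [hf' E1 /andP[_ {}hf]] := approx_in Hf Vx (@iset_hi _ (f x)).
have [hg' E2 /andP[_ {}hg]] := approx_in Hg Vx (@iset_hi _ (g x)).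
rewrite E1 E2 lee_fin; lra.
Qed.

Lemma osc2 f g U e : open U -> U !=set0 -> 0 < e ->
  exists V a b, [/\ open V, V !=set0, V `<=` U &
    approx f V a e /\ approx g V b e].
Proof.
move=> oU U0 e0; have [V [a [oV V0 VU fV]]] := osc f oU U0 e0.
have [V' [b [oV' V0' V'V gV]]] := osc g oV V0 e0.
exists V', a, b; split=> //; first exact: subset_trans VU.
by split => //; exact: approxS fV.
Qed.

Lemma fadd_Gamma f g : nowhere_dense (Gamma (fadd f g)).
Proof.
apply/nowhere_denseP => U oU U0.
have [V [a [b [oV V0 VU [fV gV]]]]] := osc2 f g oU U0 ltr01.
by exists V; split=> //; exact: approx_Gamma (approx_add fV gV).
Qed.

Lemma hadd_ex f g : exists h, forall x, iset (h x) `<=` iadd (f x) (g x).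
Proof.
have [||h hfg] := @ex_Hnf R X (fadd f g).
- by apply: S_continuous_add; exact: Hnf_S.
- exact: fadd_Gamma.
by exists h => x y /hfg; exact: fadd_sub.
Qed.

Lemma haddP f g x : iset (hadd f g x) `<=` iadd (f x) (g x).
Proof. exact: (xgetPex (inc 0) (hadd_ex f g)). Qed.

Lemma hadd_approx f g h V a b d :
  (forall x, iset (h x) `<=` iadd (f x) (g x)) ->
  approx f V a d -> approx g V b d -> approx h V (a + b) (2 * d).
Proof.
move=> hfg Hf Hg; apply: approx_sub (approx_add Hf Hg).
by move=> x y /hfg; exact: sub_fadd.
Qed.

Lemma hadd_unique f g (h : X -> ivl R) : H_continuous h ->
  (forall x, iset (h x) `<=` iadd (f x) (g x)) -> h = hadd f g.
Proof.
move=> Hh hfg.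
have hsub : subfun h (fadd f g) by move=> x y /hfg; exact: sub_fadd.
pose k := MkHnf Hh (nearly_finite_sub (proj1 Hh) hsub (@fadd_Gamma f g)).
suff kE : k = hadd f g by rewrite -kE.
apply: Hnf_eq_approx => U e oU U0 e0.
have e2 : 0 < e / 2 by lra.
have [V [a [b [oV V0 VU [fV gV]]]]] := osc2 f g oU U0 e2.
exists V, (a + b); split=> //; have -> : e = 2 * (e / 2) by lra.
by split; apply: hadd_approx fV gV => //; exact: haddP.
Qed.

(* The interval [c - e, c + e] on V and the whole extended line elsewhere. *)
Lemma le_box (V : set X) (c e : R) (e0 : 0 <= e) x :
  ((if `[< V x >] then (c - e)%:E else -oo) <=
   (if `[< V x >] then (c + e)%:E else +oo))%E.
Proof. by case: asboolP => _ //; rewrite lee_fin; lra. Qed.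

Lemma box_S (V : set X) (c e : R) (e0 : 0 <= e) : open V ->
  S_continuous (fun x => Ivl (@le_box V c e e0 x)).
Proof.
move=> oV; apply: S_continuousP => x d /=.
  case: asboolP => [Vx|_]; last by rewrite ltNge leey.
  move=> cd; apply: filterS (open_nbhs_nbhs (conj oV Vx)) => y Vy.
  by rewrite asboolT.
case: asboolP => [Vx|_]; last by rewrite ltNge leNye.
move=> cd; apply: filterS (open_nbhs_nbhs (conj oV Vx)) => y Vy.
by rewrite asboolT.
Qed.

Lemma hmul_approx f g (h : X -> ivl R) V a b d M : open V -> 0 <= d <= 1 ->
  `|a| <= M -> `|b| <= M ->
  sub_mul_hull f g h -> approx f V a d -> approx g V b d ->
  approx h V (a * b) (d * (1 + 2 * M)).
Proof.
move=> oV /andP[d0 d1] aM bM hfg fV gV.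
have M0 : 0 <= M by exact: le_trans aM.
have e0 : 0 <= d * (1 + 2 * M) by rewrite mulr_ge0 //; lra.
have Hb := hfg _ (@box_S V (a * b) _ e0 oV).
move=> x Vx; have /iset_sub : iset (h x) `<=` iset (Ivl (@le_box V (a * b) _ e0 x)).
  apply: Hb => {x Vx}x y [y1 fy1] [y2 gy2].
  rewrite /iset /=; case: asboolP => [Vx|_]; last by rewrite leNye leey.
  have [r -> {fy1}] := approx_in fV Vx fy1.
  have [s -> {gy2}] := approx_in gV Vx gy2.
  rewrite /emul /= => sb ra ->; rewrite -EFinM !lee_fin.
  have : `|r * s - a * b| <= d * (1 + 2 * M).
    have -> : r * s - a * b = (r - a) * (s - b) + (a * (s - b) + b * (r - a)).
      by ring.
    have H1 : `|r - a| <= d by rewrite ler_norml; lra.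
    have H2 : `|s - b| <= d by rewrite ler_norml; lra.
    apply: le_trans (ler_normD _ _) _.
    have : `|(r - a) * (s - b)| <= d * 1.
      by rewrite normrM ler_pM //; exact: le_trans d1.
    have : `|a * (s - b) + b * (r - a)| <= M * d + M * d.
      by apply: le_trans (ler_normD _ _) _; rewrite !normrM lerD // ler_pM.
    by lra.
  by rewrite ler_norml; lra.
by rewrite /= asboolT.
Qed.

Lemma ex_mul_hull f g : exists phi : X -> ivl R, [/\ S_continuous phi,
  forall x, imul (f x) (g x) `<=` iset (phi x), sub_mul_hull f g phi &
  nowhere_dense (Gamma phi)].
Proof.
have [|hull [Shull inhull minhull]] := @ex_hull R X (fun x => imul (f x) (g x)).
  move=> x; have : emul (lo (f x)) (lo (g x)) !=set0.
    rewrite /emul; case: ifP => _; first by eexists.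
    by case: ifP => _; exists 0%E => /=; rewrite lexx.
  move=> [y yfg]; exists y; exists (lo (f x)); first exact: iset_lo.
  by exists (lo (g x)) => //; exact: iset_lo.
exists hull; split=> //; apply/nowhere_denseP => U oU U0.
have [V [a [b [oV V0 VU [fV gV]]]]] := osc2 f g oU U0 ltr01.
exists V; split=> //.
apply: (@approx_Gamma _ _ hull V (a * b)).
apply: (@hmul_approx f g hull V a b 1 (`|a| + `|b|)) => //.
- by rewrite ler01 lexx.
- by rewrite lerDl.
- by rewrite lerDr.
Qed.

Lemma hmul_ex f g : exists h : H, sub_mul_hull f g h.
Proof.
have [hull [Shull _ minhull Ghull]] := ex_mul_hull f g.
have [h hh] := ex_Hnf Shull Ghull.
by exists h => phi cphi /(minhull _ cphi) sub x y /hh /sub.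
Qed.

Lemma hmulP f g : sub_mul_hull f g (hmul f g).
Proof. exact: (xgetPex (inc 0) (hmul_ex f g)). Qed.

(* On the part of X where f, g, h have small oscillation, u is close to the
   value of P at (f, g, h). All ring identities reduce to identities on R
   through isP_unique. *)
Definition isP f g h u (P : R -> R -> R -> R) := forall M, 0 <= M ->
  (exists2 K, 0 <= K & forall a b c, `|a| <= M -> `|b| <= M -> `|c| <= M ->
    `|P a b c| <= K) /\
  forall e, 0 < e -> exists2 d, 0 < d & forall (V : set X) a b c, open V ->
    `|a| <= M -> `|b| <= M -> `|c| <= M ->
    approx f V a d -> approx g V b d -> approx h V c d ->
    approx u V (P a b c) e.

Lemma isP_unique f g h u v P : isP f g h u P -> isP f g h v P -> u = v.
Proof.
move=> Hu Hv; apply: Hnf_eq_approx => U e oU U0 e0.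
have [V [a [b [oV V0 VU [fV gV]]]]] := osc2 f g oU U0 ltr01.
have [V' [c [oV' V'0 V'V hV]]] := osc h oV V0 ltr01.
pose M := `|a| + `|b| + `|c| + 2.
have a0 := normr_ge0 a; have b0 := normr_ge0 b; have c0 := normr_ge0 c.
have M0 : 0 <= M by rewrite /M; lra.
have [_ /(_ _ e0)[d1 d10 Hu1]] := Hu M M0.
have [_ /(_ _ e0)[d2 d20 Hv2]] := Hv M M0.
pose d := Num.min 1 (Num.min d1 d2).
have d0 : 0 < d by rewrite !lt_min d10 d20 ltr01.
have dd1 : d <= d1 by rewrite /d !ge_min lexx !orbT.
have dd2 : d <= d2 by rewrite /d !ge_min lexx !orbT.
have dd : d <= 1 by rewrite /d !ge_min lexx.
have [W1 [a' [b' [oW W0 WV [fW gW]]]]] := osc2 f g oV' V'0 d0.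
have [W' [c' [oW' [x W'x] W'W hW]]] := osc h oW W0 d0.
have near (k : H) (A B : set X) s t : A x -> B x ->
    approx k A s 1 -> approx k B t d -> `|t| <= `|s| + 2.
  move=> Ax Bx kA kB.
  have [r Er /andP[? ?]] := approx_in kA Ax (@iset_lo _ (k x)).
  have [r' + /andP[? ?]] := approx_in kB Bx (@iset_lo _ (k x)).
  rewrite Er => -[rr']; subst r'.
  have := ler_norm s; have := ler_norm (- s); rewrite normrN ler_norml => ? ?.
  by apply/andP; split; lra.
have Wx := W'W _ W'x; have V'x := WV _ Wx; have Vx := V'V _ V'x.
have aM : `|a'| <= M by have := near f V W1 a a' Vx Wx fV fW; rewrite /M; lra.
have bM : `|b'| <= M by have := near g V W1 b b' Vx Wx gV gW; rewrite /M; lra.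
have cM : `|c'| <= M by have := near h V' W' c c' V'x W'x hV hW; rewrite /M; lra.
exists W', (P a' b' c'); split=> //.
- by exists x.
- by move=> y /W'W/WV/V'V/VU.
have fW' := approxS W'W fW; have gW' := approxS W'W gW.
split.
  by apply: Hu1 => //; [exact: approxW fW'|exact: approxW gW'|exact: approxW hW].
by apply: Hv2 => //; [exact: approxW fW'|exact: approxW gW'|exact: approxW hW].
Qed.

Lemma isP1 f g h : isP f g h f (fun a _ _ => a).
Proof. by move=> M M0; split; [exists M|move=> e e0; exists e]. Qed.

Lemma isP2 f g h : isP f g h g (fun _ b _ => b).
Proof. by move=> M M0; split; [exists M|move=> e e0; exists e]. Qed.

Lemma isP3 f g h : isP f g h h (fun _ _ c => c).
Proof. by move=> M M0; split; [exists M|move=> e e0; exists e]. Qed.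

Lemma isPc f g h (p : C) (r : R) : (forall x, p x = r) ->
  isP f g h (inc p) (fun _ _ _ => r).
Proof.
move=> pr M M0; split; first by exists `|r|.
move=> e e0; exists 1 => // V a b c _ _ _ _ _ _ _ x Vx /=.
by rewrite pr !lee_fin; lra.
Qed.

Lemma isPN f g h u P : isP f g h u P ->
  isP f g h (hopp u) (fun a b c => - P a b c).
Proof.
move=> Hu M M0; have [[K K0 HK] He] := Hu M M0; split.
  by exists K => // a b c *; rewrite normrN; exact: HK.
move=> e e0; have [d d0 Hd] := He e e0; exists d => // V a b c *.
move=> x Vx; have [//|//|//|//|//|//|//|l r] := Hd V a b c _ _ _ _ _ _ _ x Vx.
by rewrite /= leeNr leeNl -!EFinN; split;
  [apply: le_trans r _|apply: le_trans _ l]; rewrite lee_fin; lra.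
Qed.

Lemma isPD f g h u v P Q : isP f g h u P -> isP f g h v Q ->
  isP f g h (hadd u v) (fun a b c => P a b c + Q a b c).
Proof.
move=> Hu Hv M M0; have [[K K0 HK] He] := Hu M M0.
have [[L L0 HL] Hf] := Hv M M0; split.
  exists (K + L); first lra.
  by move=> a b c *; apply: le_trans (ler_normD _ _) _; rewrite lerD ?HK ?HL.
move=> e e0; have e2 : 0 < e / 2 by lra.
have [d d0 Hd] := He _ e2; have [d' d'0 Hd'] := Hf _ e2.
exists (Num.min d d'); first by rewrite lt_min d0.
move=> V a b c oV aM bM cM fV gV hV.
have -> : e = 2 * (e / 2) by lra.
have m1 : Num.min d d' <= d by rewrite ge_min lexx.
have m2 : Num.min d d' <= d' by rewrite ge_min lexx orbT.
apply: hadd_approx; first exact: haddP.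
  by apply: Hd => //; apply: approxW m1 _.
by apply: Hd' => //; apply: approxW m2 _.
Qed.

Lemma isPM f g h u v P Q : isP f g h u P -> isP f g h v Q ->
  isP f g h (hmul u v) (fun a b c => P a b c * Q a b c).
Proof.
move=> Hu Hv M M0; have [[K K0 HK] He] := Hu M M0.
have [[L L0 HL] Hf] := Hv M M0; split.
  exists (K * L); first by rewrite mulr_ge0.
  by move=> a b c *; rewrite normrM ler_pM ?HK ?HL.
move=> e e0; pose N := 1 + 2 * (K + L).
have N0 : 0 < N by rewrite /N; lra.
pose t := Num.min 1 (e / N).
have t0 : 0 < t by rewrite lt_min ltr01 divr_gt0.
have [d d0 Hd] := He _ t0; have [d' d'0 Hd'] := Hf _ t0.
exists (Num.min d d'); first by rewrite lt_min d0.
move=> V a b c oV aM bM cM fV gV hV.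
have m1 : Num.min d d' <= d by rewrite ge_min lexx.
have m2 : Num.min d d' <= d' by rewrite ge_min lexx orbT.
apply: (@approxW _ _ _ _ _ (t * N)).
  by rewrite -ler_pdivlMr // /t ge_min lexx orbT.
apply: (@hmul_approx u v) => //.
- by rewrite (ltW t0) /t ge_min lexx.
- by apply: le_trans (HK _ _ _ _ _ _) _ => //; lra.
- by apply: le_trans (HL _ _ _ _ _ _) _ => //; lra.
- exact: hmulP.
- by apply: Hd => //; apply: approxW m1 _.
- by apply: Hd' => //; apply: approxW m2 _.
Qed.

Lemma isP_ext f g h u P Q : (forall a b c, P a b c = Q a b c) ->
  isP f g h u P -> isP f g h u Q.
Proof.
move=> PQ; have -> // : P = Q.
by apply/funext => a; apply/funext => b; apply/funext => c.
Qed.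

Lemma hmul_unique f g (h : X -> ivl R) : H_continuous h ->
  sub_mul_hull f g h -> h = hmul f g.
Proof.
move=> Hh sh; have [hull [Shull inhull minhull Ghull]] := ex_mul_hull f g.
have hsub := sh _ Shull inhull.
pose k := MkHnf Hh (nearly_finite_sub (proj1 Hh) hsub Ghull).
suff kE : k = hmul f g by rewrite -kE.
apply: (@isP_unique f g g _ _ (fun a b _ => a * b)); last first.
  by apply: isPM; [exact: isP1|exact: isP2].
move=> M M0; split; first by exists (M * M); rewrite ?mulr_ge0// => *; rewrite normrM ler_pM.
move=> e e0; pose N := 1 + 2 * M; have N0 : 0 < N by rewrite /N; lra.
pose t := Num.min 1 (e / N).
have t0 : 0 < t by rewrite lt_min ltr01 divr_gt0.
exists t => // V a b c oV aM bM _ fV gV _.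
apply: (@approxW _ _ _ _ _ (t * N)).
  by rewrite -ler_pdivlMr // /t ge_min lexx orbT.
apply: (@hmul_approx f g) => //.
by rewrite (ltW t0) /t ge_min lexx.
Qed.

Lemma hmul_unique_sub f g (h : X -> ivl R) : H_continuous h ->
  (forall x, iset (h x) `<=` imul (f x) (g x)) -> h = hmul f g.
Proof.
by move=> Hh hfg; apply: hmul_unique => // phi _ s x y /hfg /s.
Qed.

Ltac isP_tac := repeat first
  [ apply: isPM | apply: isPD | apply: isPN | exact: isP1 | exact: isP2
  | exact: isP3 ].

Lemma haddA : associative hadd.
Proof.
move=> f g h; apply: (@isP_unique f g h); first by isP_tac.
apply: (@isP_ext _ _ _ _ (fun a b c => a + b + c)); last by isP_tac.
by move=> *; ring.
Qed.
Lemma haddC : commutative hadd.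
Proof.
move=> f g; apply: (@isP_unique f g g _ _ (fun a b _ => a + b)).
  by isP_tac.
apply: (@isP_ext _ _ _ _ (fun a b c => b + a)); last by isP_tac.
by move=> *; ring.
Qed.
Lemma hadd0 : left_id (inc 0) hadd.
Proof.
move=> f; apply: (@isP_unique f f f _ _ (fun a _ _ => a)); last by isP_tac.
apply: (@isP_ext _ _ _ _ (fun a b c => 0 + a)); first by move=> *; ring.
by apply: isPD; [exact: isPc|isP_tac].
Qed.
Lemma haddN : left_inverse (inc 0) hopp hadd.
Proof.
move=> f; apply: (@isP_unique f f f _ _ (fun a _ _ => 0)); last exact: isPc.
apply: (@isP_ext _ _ _ _ (fun a b c => - a + a)); first by move=> *; ring.
by isP_tac.
Qed.
HB.instance Definition _ := GRing.isZmodule.Build H haddA haddC hadd0 haddN.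

Lemma hmulA : associative hmul.
Proof.
move=> f g h; apply: (@isP_unique f g h); first by isP_tac.
apply: (@isP_ext _ _ _ _ (fun a b c => a * b * c)); last by isP_tac.
by move=> *; ring.
Qed.
Lemma hmulC : commutative hmul.
Proof.
move=> f g; apply: (@isP_unique f g g _ _ (fun a b _ => a * b)).
  by isP_tac.
apply: (@isP_ext _ _ _ _ (fun a b c => b * a)); last by isP_tac.
by move=> *; ring.
Qed.
Lemma hmul1 : left_id (inc 1) hmul.
Proof.
move=> f; apply: (@isP_unique f f f _ _ (fun a _ _ => a)); last by isP_tac.
apply: (@isP_ext _ _ _ _ (fun a b c => 1 * a)); first by move=> *; ring.
by apply: isPM; [exact: isPc|isP_tac].
Qed.
Lemma hmulDl : left_distributive hmul hadd.
Proof.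
move=> f g h; apply: (@isP_unique f g h _ _ (fun a b c => (a + b) * c)).
  by isP_tac.
apply: (@isP_ext _ _ _ _ (fun a b c => a * c + b * c)); last by isP_tac.
by move=> *; ring.
Qed.
HB.instance Definition _ :=
  GRing.Zmodule_isComPzRing.Build H hmulA hmulC hmul1 hmulDl.

Lemma iset_ipt (y z : \bar R) : iset (ipt y) z -> z = y.
Proof. by move=> /andP[? ?]; apply/eqP; rewrite eq_le; apply/andP. Qed.

Lemma inc_is_zmod_morphism : zmod_morphism inc.
Proof.
move=> p q; apply: Hnf_eq; apply: (@hadd_unique (inc p) (hopp (inc q)));
  first exact: Hnf_H.
move=> x y /iset_ipt ->.
exists (p x)%:E; first exact: iset_lo.
by exists (- (q x)%:E)%E; [exact: iset_lo|rewrite /eadd].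
Qed.

Lemma inc_is_monoid_morphism : monoid_morphism inc.
Proof.
split=> // p q; apply: Hnf_eq; apply: hmul_unique_sub; first exact: Hnf_H.
move=> x y /iset_ipt ->.
exists (p x)%:E; first exact: iset_lo.
by exists (q x)%:E; [exact: iset_lo|rewrite /emul].
Qed.

HB.instance Definition _ :=
  GRing.isZmodMorphism.Build C H inc inc_is_zmod_morphism.
HB.instance Definition _ :=
  GRing.isMonoidMorphism.Build C H inc inc_is_monoid_morphism.

Lemma approx_pt f x (a : R) : iset (f x) = [set a%:E] ->
  forall e, 0 < e -> \forall y \near x,
    ((a - e)%:E <= lo (f y))%E /\ (hi (f y) <= (a + e)%:E)%E.
Proof.
move=> fx e e0.
have := @iset_lo _ (f x); have := @iset_hi _ (f x); rewrite fx => /= hx lx.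
have H1 : \forall y \near x, (hi (f y) < (a + e)%:E)%E.
  by apply: S_continuous_hi; [exact: Hnf_S|rewrite hx lte_fin; lra].
have H2 : \forall y \near x, ((a - e)%:E < lo (f y))%E.
  by apply: S_continuous_lo; [exact: Hnf_S|rewrite lx lte_fin; lra].
by apply: filterS2 H1 H2 => y /ltW ? /ltW.
Qed.

Lemma finite_pt f x : ~ W f x -> ~ Gamma f x -> exists a : R, iset (f x) = [set a%:E].
Proof.
move=> nW nG; have hin := @iset_hi _ (f x); have lin := @iset_lo _ (f x).
have lh := lo_le_hi (f x).
move: nW; rewrite /W /= /width.
case E1: (lo (f x)) lin lh => [a| |] lin lh; case E2: (hi (f x)) hin lh => [b| |] hin lh //;
  try by [case: nG; left|case: nG; right].
move=> /negP; rewrite -leNgt lee_fin => ba; rewrite lee_fin in lh.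
have ab : a = b by lra.
exists a; apply/seteqP; split=> [y|y ->]; last by rewrite -E1; exact: iset_lo.
rewrite /iset /= E1 E2 -ab => ?; apply/eqP; by rewrite eq_le andbC.
Qed.

Lemma W_pt f x (a : R) : iset (f x) = [set a%:E] -> ~ W f x.
Proof.
move=> fx; have := @iset_lo _ (f x); have := @iset_hi _ (f x).
by rewrite fx /W /= /width => -> -> /=; rewrite subrr ltxx.
Qed.

Lemma isP_W f g h u P : isP f g h u P -> W u `<=`
  (W f `|` Gamma f) `|` (W g `|` Gamma g) `|` (W h `|` Gamma h).
Proof.
move=> Hu x Wu; apply: contrapT => /not_orP[/not_orP[/not_orP[Wf Gf] /not_orP[Wg Gg]]
  /not_orP[Wh Gh]].
have [a fx] := finite_pt Wf Gf; have [b gx] := finite_pt Wg Gg.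
have [c hx] := finite_pt Wh Gh; move: Wu; apply: (@W_pt _ _ (P a b c)).
pose M := `|a| + `|b| + `|c|.
have a0 := normr_ge0 a; have b0 := normr_ge0 b; have c0 := normr_ge0 c.
have M0 : 0 <= M by rewrite /M; lra.
have [_ He] := Hu M M0.
have K e : 0 < e -> ((P a b c - e)%:E <= lo (u x))%E /\ (hi (u x) <= (P a b c + e)%:E)%E.
  move=> e0; have [d d0 Hd] := He e e0.
  have Nf := approx_pt fx d0; have Ng := approx_pt gx d0; have Nh := approx_pt hx d0.
  have := filterI (filterI Nf Ng) Nh; set A := (X in nbhs x X) => xA.
  apply: (Hd (A^°) a b c) => //.
  - exact: open_interior.
  - by rewrite /M; lra.
  - by rewrite /M; lra.
  - by rewrite /M; lra.
  - by move=> y /interior_subset [[]].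
  - by move=> y /interior_subset [[]].
  - by move=> y /interior_subset [].
  - exact: xA.
have L : ((P a b c)%:E <= lo (u x))%E.
  rewrite leNgt; apply/negP => /ereal_real_between[r [lr]]; rewrite lte_fin => rP.
  have r0 : 0 < P a b c - r by lra.
  have [+ _] := K _ r0.
  by rewrite leNgt (lt_le_trans lr) // lee_fin; lra.
have L' : (hi (u x) <= (P a b c)%:E)%E.
  rewrite leNgt; apply/negP => /ereal_real_between[r [+ lr]]; rewrite lte_fin => rP.
  have r0 : 0 < r - P a b c by lra.
  have [_ +] := K _ r0.
  by rewrite leNgt (le_lt_trans _ lr) // lee_fin; lra.
apply/seteqP; split=> [y /andP[l h']|y -> /=].
  apply/eqP; rewrite eq_le.
  by rewrite (le_trans h' L') (le_trans L l).
rewrite /iset /= ; apply/andP; split.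
  exact: le_trans (lo_le_hi _) L'.
exact: le_trans L (lo_le_hi _).
Qed.

Definition Hnd_pred : {pred H} := fun f => `[< nowhere_dense (closure (W f)) >].

Lemma Hnd_pred_isP f g h u P : isP f g h u P ->
  f \in Hnd_pred -> g \in Hnd_pred -> h \in Hnd_pred -> u \in Hnd_pred.
Proof.
move=> /isP_W sub /asboolP Hf /asboolP Hg /asboolP Hh; apply/asboolP.
apply: nowhere_dense_closure; apply: (nowhere_denseS sub).
have K (k : H) : nowhere_dense (closure (W k)) -> nowhere_dense (W k `|` Gamma k).
  move=> Hk; apply: nowhere_denseU; last by case: (Hnf_nearly_finite k).
  exact: nowhere_denseS (@subset_closure _ _) Hk.
by apply: nowhere_denseU; [apply: nowhere_denseU|]; exact: K.
Qed.

Lemma W_inc p : W (inc p) = set0.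
Proof. by apply/seteqP; split => // x; rewrite /W /= /width /= subrr ltxx. Qed.

Lemma inc_Hnd p : inc p \in Hnd_pred.
Proof.
by apply/asboolP; rewrite W_inc closure0; exact: nowhere_dense0.
Qed.

Lemma Hnd_subring : subring_closed Hnd_pred.
Proof.
split=> [|f g Hf Hg|f g Hf Hg]; first exact: inc_Hnd.
  by apply: (@Hnd_pred_isP f g g _ (fun a b _ => a + - b)) => //;
    change (f - g) with (hadd f (hopp g)); isP_tac.
by apply: (@Hnd_pred_isP f g g _ (fun a b _ => a * b)) => //;
    change (f * g) with (hmul f g); isP_tac.
Qed.
Record Hnd := MkHnd { Hnd_val : H; HndP : Hnd_val \in Hnd_pred }.

HB.instance Definition _ := [isSub for Hnd_val].
HB.instance Definition _ := [Choice of Hnd by <:].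
HB.instance Definition _ :=
  GRing.SubChoice_isSubComPzRing.Build H Hnd_pred Hnd Hnd_subring.

Definition inc_nd p : Hnd := MkHnd (inc_Hnd p).

Lemma inc_nd_is_zmod_morphism : zmod_morphism inc_nd.
Proof. by move=> p q; apply: val_inj; rewrite /= !raddfB. Qed.

Lemma inc_nd_is_monoid_morphism : monoid_morphism inc_nd.
Proof.
by split=> [|p q]; apply: val_inj; rewrite /= ?rmorph1 ?rmorphM.
Qed.

HB.instance Definition _ :=
  GRing.isZmodMorphism.Build C Hnd inc_nd inc_nd_is_zmod_morphism.
HB.instance Definition _ :=
  GRing.isMonoidMorphism.Build C Hnd inc_nd inc_nd_is_monoid_morphism.

Definition zero_set (Z : set X) := exists p : C, Z = [set x | p x = 0].

Definition Hsz_pred : {pred H} := fun f =>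
  `[< exists Z, [/\ zero_set Z, nowhere_dense Z & W f `<=` Z] >].

End HnfRing.

Section RingsOfQuotients.

Definition rational_extension (A B : comPzRingType) (i : {rmorphism A -> B}) :=
  injective i /\
  forall b c : B, (forall a : A, (exists a' : A, b * i a = i a') -> c * i a = 0) ->
    c = 0.

(* B is the largest rational extension of A: it contains a copy over A of any
   other one; this determines B up to isomorphism over A. *)
Definition maximal_rational_extension (A B : comPzRingType)
    (i : {rmorphism A -> B}) :=
  rational_extension i /\
  forall (C : comPzRingType) (j : {rmorphism A -> C}), rational_extension j ->
    exists2 k : {rmorphism C -> B}, injective k & forall a, k (j a) = i a.

Definition non_zero_divisor (A : comPzRingType) (q : A) :=
  forall a : A, q * a = 0 -> a = 0.

Definition fractions (A B : comPzRingType) (i : {rmorphism A -> B}) : set B :=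
  [set b | exists p q r, [/\ non_zero_divisor q, i q * r = 1 & b = i p * r]].

End RingsOfQuotients.

(* Main.v *)
Require Import Defs.
From HB Require Import structures.
From mathcomp Require Import all_boot all_order all_algebra.
From mathcomp Require Import all_classical all_reals all_analysis.
From mathcomp Require Import ring lra.

Set Implicit Arguments.
Unset Strict Implicit.
Unset Printing Implicit Defensive.

Import Order.TTheory GRing.Theory Num.Theory.
Import numFieldNormedType.Exports.

Local Open Scope classical_set_scope.
Local Open Scope ring_scope.

                                                                                 
                                                                                 
                                                                           
                                                                               
                                                                              
                                                                                
                                                                  
                                                                             

                                                                       
                                                                              
                                                           
                             

                                                                              
                                                                             
                                                                       
                                                                              
                                                                       
                                                                            
                                                   

                                                                            
                                                                            
                                                                            
                                                             
                                                                        
                                                                   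
                                                                          
                                                                         

                            

Section RationalExtensions.
Context (A B : comPzRingType).
Implicit Types (i : {rmorphism A -> B}) (S T : set A).

Definition rationally_dense S :=
  forall a : A, (forall s, S s -> a * s = 0) -> a = 0.

Definition conductor i (b : B) : set A := [set a | exists a', b * i a = i a'].

                                                                               
                                                                            
Lemma rational_annihilator i S (b : B) : rational_extension i ->
  rationally_dense S -> (forall s, S s -> b * i s = 0) -> b = 0.
Proof.
move=> [inji ri] dS bS; apply: (ri b) => a [a' ba].
rewrite ba (dS a') ?rmorph0// => s Ss; apply: inji.
by rewrite rmorphM -ba mulrAC bS// mul0r rmorph0.
Qed.

Lemma rationally_dense_conductor i (b : B) : rational_extension i ->
  rationally_dense (conductor i b).
Proof.
move=> [inji ri] a ab; apply: inji; rewrite rmorph0; apply: (ri b) => s sb.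
by rewrite -rmorphM ab// rmorph0.
Qed.

Lemma rationally_denseM S T : rationally_dense S -> rationally_dense T ->
  rationally_dense [set a | exists s t, [/\ S s, T t & a = s * t]].
Proof.
move=> dS dT a aST; apply: dS => s Ss; apply: dT => t Tt.
by rewrite -mulrA; apply: aST; exists s, t.
Qed.

                                                                               
                                                                         
Definition compatible S (phi : A -> A) :=
  forall s t, S s -> S t -> phi s * t = s * phi t.

End RationalExtensions.

Section Maximality.
Context (A B : comPzRingType) (i : {rmorphism A -> B}).
Hypothesis rat_i : rational_extension i.
Hypothesis realizable : forall (S : set A) (phi : A -> A),
  rationally_dense S -> compatible S phi ->
  exists b, forall s, S s -> b * i s = i (phi s).

                                                                              
                                                                           
                                                                                
                                                                              
                                              
Lemma maximal_of_realizable : maximal_rational_extension i.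
Proof.
split=> // C j rat_j; have [inji _] := rat_i; have [injj rj] := rat_j.
have dj c : rationally_dense (conductor j c).
  exact: rationally_dense_conductor.
have spec c : exists b, forall a a', c * j a = j a' -> b * i a = i a'.
  have /choice[phi phiP] a : exists a', conductor j c a -> c * j a = j a'.
    have [[a' ca]|nc] := pselect (conductor j c a); first by exists a'.
    by exists 0 => /nc.
  have cphi : compatible (conductor j c) phi.
    move=> s t Ss St; apply: injj; rewrite !rmorphM -!phiP//.
    by rewrite -mulrA mulrCA.
  have [b bP] := realizable (dj c) cphi.
  exists b => a a' ca; have Sa : conductor j c a by exists a'.
  by rewrite bP//; congr (i _); apply: injj; rewrite -phiP.
have [k kP] := choice spec.
have kE c b : (forall a a', c * j a = j a' -> b * i a = i a') -> k c = b.
  move=> bP; apply/subr0_eq/(rational_annihilator rat_i (dj c)) => a [a' ca].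
  by rewrite mulrBl (kP c a a')// (bP a a')// subrr.
have k_add : zmod_morphism k.
  move=> c d; apply/subr0_eq.
  apply: (rational_annihilator rat_i (rationally_denseM (dj c) (dj d))).
  move=> _ [s [t [[s' cs] [t' dt] ->]]].
  have cd : (c - d) * j (s * t) = j (s' * t - s * t').
    by rewrite rmorphB !rmorphM -cs -dt; ring.
  rewrite mulrBl (kP _ _ _ cd) rmorphB !rmorphM -(kP _ _ _ cs) -(kP _ _ _ dt).
  by ring.
have k_mul : monoid_morphism k.
  split; first by apply: kE => a a'; rewrite !mul1r => /injj ->.
  move=> c d; apply/subr0_eq.
  apply: (rational_annihilator rat_i (rationally_denseM (dj c) (dj d))).
  move=> _ [s [t [[s' cs] [t' dt] ->]]].
  have cd : (c * d) * j (s * t) = j (s' * t').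
    by rewrite !rmorphM -cs -dt; ring.
  rewrite mulrBl (kP _ _ _ cd) !rmorphM -(kP _ _ _ cs) -(kP _ _ _ dt).
  by ring.
pose K : {rmorphism C -> B} := HB.pack k
  (GRing.isZmodMorphism.Build _ _ k k_add)
  (GRing.isMonoidMorphism.Build _ _ k k_mul).
exists K => [c d /= kcd|a]; last first.
  by apply: kE => b a'; rewrite -!rmorphM => /injj ->.
apply/subr0_eq/(rj (c - d)) => a [a' ca].
rewrite ca; suff -> : a' = 0 by rewrite rmorph0.
by apply: inji; rewrite rmorph0 -(kP _ _ _ ca) k_add kcd subrr mul0r.
Qed.

End Maximality.

                              

Section Fractions.
Context (A B : comPzRingType) (i : {rmorphism A -> B}).

Lemma fractions_subring_closed (P : {pred B}) :
  [set b | b \in P] = fractions i -> subring_closed P.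
Proof.
move=> PE; have inP b : b \in P <-> fractions i b by rewrite -PE.
have nzdM (q q' : A) : non_zero_divisor q -> non_zero_divisor q' ->
    non_zero_divisor (q * q').
  by move=> nq nq' a; rewrite -mulrA => /nq /nq'.
split=> [|b b' /inP[p [q [r [nq qr ->]]]] /inP[p' [q' [r' [nq' qr' ->]]]]
         |b b' /inP[p [q [r [nq qr ->]]]] /inP[p' [q' [r' [nq' qr' ->]]]]];
  apply/inP.
- by exists 1, 1, 1; rewrite rmorph1 mulr1; split=> // a; rewrite mul1r.
- exists (p * q' - p' * q), (q * q'), (r * r'); split; first exact: nzdM.
    by rewrite rmorphM mulrACA qr qr' mulr1.
  have -> : i (p * q' - p' * q) * (r * r') =
      i p * r * (i q' * r') - i p' * r' * (i q * r).
    by rewrite rmorphB !rmorphM; ring.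
  by rewrite qr qr' !mulr1.
- exists (p * p'), (q * q'), (r * r'); split; first exact: nzdM.
    by rewrite rmorphM mulrACA qr qr' mulr1.
  by rewrite rmorphM mulrACA.
Qed.

End Fractions.

                                                                      

Section Values.
Context (R : realType) (X : topologicalType).
Local Notation C := (continuousType X R).
Implicit Types (f g : Hnf R X) (p q z : C).

Definition has_val f x (a : R) := iset (f x) = [set a%:E].

Lemma has_val_sub f x a : iset (f x) `<=` [set a%:E] -> has_val f x a.
Proof.
move=> sub; apply/seteqP; split=> // _ ->.
by rewrite -(sub _ (@iset_lo _ (f x))); exact: iset_lo.
Qed.

Lemma has_val_inj f x a b : has_val f x a -> has_val f x b -> a = b.
Proof.
by rewrite /has_val => -> ab; have [] : [set b%:E] a%:E by rewrite -ab.
Qed.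

Lemma has_val_inc p x : has_val (inc p) x (p x).
Proof. by apply: has_val_sub => y; apply: iset_ipt. Qed.

Lemma inc_inj : injective (@inc R X).
Proof.
move=> p q pq; apply/continuousEP => x; have := has_val_inc q x.
by rewrite -pq; exact: has_val_inj (has_val_inc p x).
Qed.

Lemma has_val_hi f x a : has_val f x a -> hi (f x) = a%:E.
Proof. by move=> fa; have := @iset_hi _ (f x); rewrite fa. Qed.

                                                                                
                                   
Lemma has_valM f g x a b : has_val f x a -> has_val g x b ->
  has_val (f * g) x (a * b).
Proof.
move=> fa gb; pose M := `|a| + `|b|.
have a0 := normr_ge0 a; have b0 := normr_ge0 b.
have N0 : 0 < 1 + 2 * M by rewrite /M; lra.
have close e : 0 < e ->
    ((a * b - e)%:E <= lo ((f * g)%R x) /\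
     hi ((f * g)%R x) <= (a * b + e)%:E)%E.
  move=> e0; pose d := Num.min 1 (e / (1 + 2 * M)).
  have d0 : 0 < d by rewrite lt_min ltr01 divr_gt0.
  pose V := [set y |
    (((a - d)%:E <= lo (f y))%E /\ (hi (f y) <= (a + d)%:E)%E) /\
    (((b - d)%:E <= lo (g y))%E /\ (hi (g y) <= (b + d)%:E)%E)].
  have xV : nbhs x V by apply: filterI; exact: approx_pt.
  suff fgV : Defs.approx (hmul f g) V^° (a * b) e by apply: fgV.
  apply: (@approxW _ _ _ _ _ (d * (1 + 2 * M))).
    by rewrite -ler_pdivlMr// /d ge_min lexx orbT.
  apply: (@hmul_approx _ _ f g).
  - exact: open_interior.
  - by rewrite (ltW d0) /d ge_min lexx.
  - by rewrite /M; lra.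
  - by rewrite /M; lra.
  - exact: hmulP.
  - by move=> y /interior_subset[].
  - by move=> y /interior_subset[].
apply: has_val_sub => y /andP[ly yh].
case: y ly yh => [y| |] ly yh.
- congr (_%:E); apply/eqP; rewrite -subr_eq0 -normr_le0.
  apply/ler_addgt0Pl => e e0; rewrite addr0.
  have [l h] := close e e0.
  have := le_trans l ly; have := le_trans yh h.
  by rewrite !lee_fin ler_norml; lra.
- by have [_ h] := close 1 ltr01; have := le_trans yh h; rewrite leye_eq.
- by have [l _] := close 1 ltr01; have := le_trans l ly; rewrite leeNy_eq.
Qed.

Lemma Hnf_eq_dense f g (D : set X) : dense D ->
  (forall x, D x -> exists a, has_val f x a /\ has_val g x a) -> f = g.
Proof.
move=> dD fgD; apply: Hnf_eq_approx => U e oU U0 e0.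
have [x [Ux Dx]] := dD U U0 oU.
have [a [fa ga]] := fgD x Dx.
pose V := [set y | U y /\
  (((a - e)%:E <= lo (f y))%E /\ (hi (f y) <= (a + e)%:E)%E) /\
  (((a - e)%:E <= lo (g y))%E /\ (hi (g y) <= (a + e)%:E)%E)].
have xV : nbhs x V.
  apply: filterI; first exact: open_nbhs_nbhs.
  by apply: filterI; exact: approx_pt.
exists V^°, a; split; [exact: open_interior|by exists x| |].
  by move=> y /interior_subset[].
by split=> y /interior_subset[_ []].
Qed.

Lemma dense_setC (A : set X) : nowhere_dense A -> dense (~` A).
Proof.
move=> /nowhere_denseP dA U U0 oU.
have [V [_ [x Vx] VU VA]] := dA U oU U0.
exists x; split; first exact: VU.
by move=> Ax; have : (V `&` A) x by []; rewrite VA.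
Qed.

Lemma nowhere_dense_setC (V : set X) : open V -> dense V ->
  nowhere_dense (~` V).
Proof.
move=> oV dV; apply/nowhere_denseP => U oU U0.
exists (U `&` V); split; [exact: openI|exact: dV|by move=> x []|].
by apply/seteqP; split=> // x [[]].
Qed.

                                                                               
                                                                             
                                                     
Lemma ex_Hnf_extending (V : set X) (psi : X -> R) : open V -> dense V ->
  (forall x, V x -> {for x, continuous psi}) ->
  exists f, forall x, V x -> has_val f x (psi x).
Proof.
move=> oV dV cpsi.
pose phi x : ivl R :=
  if `[< V x >] then ipt (psi x)%:E else Ivl (leNye +oo%E).
have phiV x : V x -> phi x = ipt (psi x)%:E by move=> Vx; rewrite /phi asboolT.
have nearV x : V x -> \forall y \near x, V y by move=> ?; exact: open_nbhs_nbhs.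
have nbhs_psi x (A : set (\bar R)) : V x -> nbhs (psi x)%:E A ->
    \forall y \near x, A (psi y)%:E.
  by move=> Vx nA; exact: (cpsi x Vx (fun r => A r%:E)).
have near_phi x (P : ivl R -> Prop) (A : set (\bar R)) : V x -> open A ->
    (forall y, A y -> P (ipt y)) -> A (psi x)%:E ->
    \forall y \near x, P (phi y).
  move=> Vx oA AP Ax; near=> y; rewrite phiV; last by near: y; exact: nearV.
  by apply: AP; near: y; apply: nbhs_psi => //; exact: open_nbhs_nbhs.
have [||f fphi] := @ex_Hnf R X phi.
- apply: S_continuousP => x c.
    have [Vx|nVx] := pselect (V x); last by rewrite /phi asboolF//= ltNge leey.
    rewrite phiV//= => psic.
    apply: (near_phi x (fun a => hi a < c)%E [set y | y < c]%E) => //.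
    exact: open_ereal_lt_ereal.
  have [Vx|nVx] := pselect (V x); last by rewrite /phi asboolF//= ltNge leNye.
  rewrite phiV//= => psic.
  apply: (near_phi x (fun a => c < lo a)%E [set y | c < y]%E) => //.
  exact: open_ereal_gt_ereal.
- apply: nowhere_denseS (nowhere_dense_setC oV dV) => x Gx Vx.
  by move: Gx; rewrite /Gamma /= phiV// => -[] /iset_ipt.
exists f => x Vx; apply: has_val_sub => y /fphi.
by rewrite phiV// => /iset_ipt.
Unshelve. all: by end_near. Qed.

Lemma not_W_lo_hi f x : ~ W f x -> lo (f x) = hi (f x).
Proof.
have lh := lo_le_hi (f x); rewrite /W /= /width.
case: (lo (f x)) lh => [a| |]; case: (hi (f x)) => [b| |] //=;
  try by move=> _ /(_ (ltry 0)).
rewrite lee_fin => ab /negP; rewrite -leNgt lee_fin => ba.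
by congr EFin; apply/eqP; rewrite eq_le ab; lra.
Qed.

Lemma ereal_continuous_at (u : X -> \bar R) x :
  (forall c, (u x < c)%E -> \forall y \near x, (u y < c)%E) ->
  (forall c, (c < u x)%E -> \forall y \near x, (c < u y)%E) ->
  {for x, continuous u}.
Proof.
move=> uhi ulo A /=; rewrite {1}/nbhs /=.
case E: (u x) uhi ulo => [r| |] uhi ulo.
- move=> /= -[e /= e0 eA].
  have h : \forall y \near x, (u y < (r + e)%:E)%E.
    by apply: uhi; rewrite lte_fin; lra.
  have l : \forall y \near x, ((r - e)%:E < u y)%E.
    by apply: ulo; rewrite lte_fin; lra.
  apply: filterS2 h l => y; rewrite /preimage /=.
  case: (u y) => [s| |] //; rewrite !lte_fin => sr rs.
  by apply: eA; rewrite /= ltr_norml; lra.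
- by move=> [M [_ MA]]; apply: filterS (ulo M%:E (ltry _)) => y; exact: MA.
- by move=> [M [_ MA]]; apply: filterS (uhi M%:E (ltNyr _)) => y; exact: MA.
Qed.

Lemma contract_continuous : continuous (@contract R).
Proof.
move=> x; apply/cvgrPdist_lt => e e0.
exact: (nbhsx_ballx x (PosNum e0)%:num).
Qed.

                                                                              
                                                                        
                                                                          
Lemma contract_hi_continuous f x : ~ W f x ->
  {for x, continuous (fun y => contract (hi (f y)))}.
Proof.
move=> /not_W_lo_hi fx; apply: continuous_comp; last exact: contract_continuous.
apply: ereal_continuous_at => c cf.
  by apply: S_continuous_hi => //; exact: Hnf_S.
have : \forall y \near x, (c < lo (f y))%E.
  by apply: S_continuous_lo; [exact: Hnf_S|rewrite fx].
by apply: filterS => y /lt_le_trans; apply; exact: lo_le_hi.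
Qed.

Lemma continuous_mul_vanishing (t : X -> R) z : (forall x, `|t x| <= 1) ->
  (forall x, z x != 0 -> {for x, continuous t}) ->
  continuous (fun x => z x * t x).
Proof.
move=> t1 ct x.
have cz : {for x, continuous z} by exact: cts_fun.
have [zx|/ct] := eqVneq (z x) 0; last by apply: continuousM.
rewrite /continuous_at zx mul0r; apply/cvgr0Pnorm_lt => e e0.
have : z @ x --> z x by exact: cz.
rewrite zx => /cvgr0Pnorm_lt /(_ e e0).
apply: filterS => y; apply: le_lt_trans.
by rewrite normrM ler_piMr.
Qed.

                                                                                
                                                                            
                                                                     
               
Lemma ex_denominator f z : W f `<=` [set x | z x = 0] -> nowhere_dense (W f) ->
  exists p q, f * inc q = inc p /\
    forall x, q x = 0 -> z x = 0 \/ Gamma f x.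
Proof.
move=> Wz dW; pose t x := contract (hi (f x)).
have t1 x : `|t x| <= 1 by exact: contract_le1.
have ct x : z x != 0 -> {for x, continuous t}.
  by move=> zx; apply: contract_hi_continuous => /Wz; apply/eqP.
have cp : continuous (fun x => z x * t x) by exact: continuous_mul_vanishing.
have cq : continuous (fun x => z x * (1 - `|t x|)).
  apply: continuous_mul_vanishing => x.
    have := t1 x; have := normr_ge0 (t x) => t0 tx.
    by rewrite ger0_norm ?subr_ge0// gerBl.
  move=> /ct tx; apply: continuousB; first exact: cst_continuous.
  by apply: continuous_comp tx _; exact: norm_continuous.
exists (mkcts cp), (mkcts cq); split=> [|x /= /eqP].
  have dWG : nowhere_dense (W f `|` Gamma f).
    by apply: nowhere_denseU => //; case: (Hnf_nearly_finite f).
  apply: (Hnf_eq_dense (dense_setC dWG)) => x /not_orP[nW nG].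
  have [a fa] := finite_pt nW nG.
  exists (z x * t x); split; last exact: has_val_inc.
  have -> : z x * t x = a * (z x * (1 - `|t x|)).
    have a1 : 1 + `|a| != 0 by have := normr_ge0 a; lra.
    rewrite /t (has_val_hi fa) /= normrM normfV.
    rewrite (ger0_norm (x := 1 + _)) ?addr_ge0//.
    by field.
  by apply: has_valM => //; exact: (has_val_inc (mkcts cq)).
rewrite mulf_eq0 => /orP[/eqP|]; first by left.
rewrite subr_eq0 eq_sym => /eqP t_1; right.
                                                
have := @iset_hi _ (f x).
have := t_1; rewrite /t /Gamma /=.
case: (hi (f x)) => [a| |] //=; [|by right|by left].
have a1 : 0 < 1 + `|a| by have := normr_ge0 a; lra.
rewrite normrM normfV (gtr0_norm a1) => /(congr1 ( *%R^~ (1 + `|a|))).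
by rewrite mulfVK ?gt_eqF// mul1r => ?; exfalso; lra.
Qed.

End Values.

                                             

Section CozeroSets.
Context (R : realType) (X : topologicalType).
Local Notation C := (continuousType X R).
Implicit Types (q : C) (S : set C).

Definition coz S : set X := \bigcup_(s in S) [set x | s x != 0].

Lemma open_coz S : open (coz S).
Proof.
apply: bigcup_open => p _.
have -> : [set x | p x != 0] = p @^-1` [set y | y != 0] by [].
apply: open_comp => [x _|]; first exact: cts_fun.
exact: open_neq.
Qed.

Lemma coz1 q : coz [set q] = ~` [set x | q x = 0].
Proof.
by rewrite /coz bigcup_set1; apply/seteqP; split=> x /= /eqP.
Qed.

Lemma non_zero_divisorP q : non_zero_divisor q <-> rationally_dense [set q].
Proof.
split=> nq a; first by move=> /(_ q erefl); rewrite mulrC; exact: nq.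
by move=> qa; apply: nq => _ ->; rewrite mulrC.
Qed.

Lemma dense_coz_rationally_dense S : dense (coz S) -> rationally_dense S.
Proof.
move=> dS a aS; apply: inc_inj; rewrite rmorph0.
apply: (Hnf_eq_dense dS) => x [s Ss /= sx].
exists 0; split; last exact: (has_val_inc 0).
have : a x * s x = 0 by exact: (congr1 (fun p : C => p x) (aS s Ss)).
move=> /eqP; rewrite mulf_eq0 (negPf sx) orbF => /eqP <-; exact: has_val_inc.
Qed.

End CozeroSets.

                                                        

Section CompletelyRegular.
Context (R : realType) (X : topologicalType).
Hypothesis crX : completely_regular_space X.
Local Notation C := (continuousType X R).
Implicit Types (f g : Hnf R X) (p q z : C).

Lemma ex_separating (B : set X) x : closed B -> ~ B x ->
  exists z, z x = 1 /\ forall y, B y -> z y = 0.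
Proof.
move=> cB nBx.
have [h [ch _ hx hB]] := (@uniform_separatorP X R _ _).1 (crX cB nBx).
exists (cts_add (@cts_one R X) (cts_opp (mkcts ch))); split => [|y By].
  by rewrite -[LHS]/(1 - h x) (hx (h x)) ?subr0//; exists x.
by rewrite -[LHS]/(1 - h y) (hB (h y)) ?subrr//; exists y.
Qed.

                                                                          
                    
Lemma rationally_dense_coz (S : set C) : rationally_dense S -> dense (coz S).
Proof.
move=> dS U [x Ux] oU; apply: contrapT => US.
have [||z [zx zU]] := @ex_separating (~` U) x.
- exact: open_closedC.
- by move=> /(_ Ux).
have z0 : z = 0.
  apply: dS => s Ss; apply/continuousEP => y.
  rewrite -[LHS]/(z y * s y) -[RHS]/0.
  have [Uy|/zU ->] := pselect (U y); last by rewrite mul0r.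
  have [->|sy] := eqVneq (s y) 0; first by rewrite mulr0.
  by case: US; exists y; split => //; exists s.
by have := oner_neq0 R; rewrite -zx z0 => /eqP; apply.
Qed.

                                                                          
                                                                           
                                                                               
                                                           
Lemma ex_quotient (S : set C) (phi : C -> C) :
  rationally_dense S -> compatible S phi ->
  exists f, W f `<=` ~` coz S /\
    forall s, S s -> f * inc s = inc (phi s).
Proof.
move=> /rationally_dense_coz dS cphi.
pose quot s x := phi s x / s x.
have quotE s t x : S s -> S t -> s x != 0 -> phi t x = quot s x * t x.
  move=> Ss St sx; have E : phi s x * t x = s x * phi t x.
    exact: (congr1 (fun p : C => p x) (cphi _ _ Ss St)).
  by rewrite /quot mulrAC E mulrAC mulfV// mul1r.
have /choice[psi psiP] x : exists r : R, coz S x ->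
    forall s, S s -> phi s x = r * s x.
  have [[s Ss /= sx]|nSx] := pselect (coz S x); last by exists 0 => /nSx.
  by exists (quot s x) => _ t St; exact: quotE.
have cpsi x : coz S x -> {for x, continuous psi}.
  move=> [s Ss /= sx].
  have cs (p : C) : {for x, continuous p} by exact: cts_fun.
  have nearE : \forall y \near x, quot s y = psi y.
    have sN : nbhs (s x) [set y | y != 0].
      by apply: open_nbhs_nbhs; split => //; exact: open_neq.
    have : \forall y \near x, s y != 0 by exact: cs sN.
    apply: filterS => y /= sy.
    by rewrite /quot psiP ?mulfK//; exists s.
  have Ex : quot s x = psi x := nbhs_singleton nearE.
  suff : psi y @[y --> x] --> psi x by [].
  rewrite -Ex; apply: cvg_trans (near_eq_cvg nearE) _.
  by apply: continuousM => //; apply: continuousV.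
have [f fpsi] := ex_Hnf_extending (@open_coz R X S) dS cpsi.
exists f; split=> [x Wx /fpsi /W_pt//|s Ss].
apply: (Hnf_eq_dense dS) => x Sx; exists (psi x * s x); split.
  by apply: has_valM; [exact: fpsi|exact: has_val_inc].
by rewrite -psiP//; exact: has_val_inc.
Qed.

                                                                          
                                                                               
                   
Lemma inc_nd_rational :
  rational_extension (@inc_nd R X : {rmorphism C -> Hnd R X}).
Proof.
split=> [p q /(congr1 val)/inc_inj//|b c cb].
apply: val_inj; rewrite [RHS]raddf0.
pose N (f : Hnd R X) := closure (W (val f)) `|` Gamma (val f).
have dN (f : Hnd R X) : nowhere_dense (N f).
  apply: nowhere_denseU; last by case: (Hnf_nearly_finite (val f)).
  exact/asboolP/(HndP f).
have dense_bc := dense_setC (nowhere_denseU (dN b) (dN c)).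
apply: (Hnf_eq_dense dense_bc) => x.
move=> /not_orP[/not_orP[nWb nGb] /not_orP[nWc nGc]].
have [r cr] : exists r, has_val (val c) x r.
  by apply: finite_pt => // Wc; exact/nWc/subset_closure.
exists 0; split; last exact: (has_val_inc 0).
have [z [zx zW]] := ex_separating (@closed_closure _ _) nWb.
have [||p [q [bq qE]]] := @ex_denominator R X (val b) z.
- by move=> y Wy; apply/zW/subset_closure.
- by apply: nowhere_denseS (@subset_closure _ _) _; exact/asboolP/(HndP b).
have qx : q x != 0.
  by apply/eqP => /qE[|//]; rewrite zx => /eqP; rewrite oner_eq0.
have cq : val c * inc q = 0.
  have /(congr1 val)/= <- : c * inc_nd q = 0; last by [].
  by apply: cb; exists p; exact: val_inj.
have := has_valM cr (has_val_inc q x); rewrite cq => /has_val_inj.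
move=> /(_ _ (has_val_inc 0 x)) /eqP; rewrite mulf_eq0 (negPf qx) orbF.
by move=> /eqP <-.
Qed.

Lemma inc_nd_maximal :
  maximal_rational_extension (@inc_nd R X : {rmorphism C -> Hnd R X}).
Proof.
apply: maximal_of_realizable; first exact: inc_nd_rational.
move=> S phi dS cphi; have [f [fS fE]] := ex_quotient dS cphi.
have fnd : f \in @Hnd_pred R X.
  apply/asboolP/nowhere_dense_closure/(nowhere_denseS fS).
  exact: nowhere_dense_setC (@open_coz R X S) (rationally_dense_coz dS).
by exists (MkHnd fnd) => s Ss; apply: val_inj; exact: fE.
Qed.

Lemma ex_fraction p q : non_zero_divisor q ->
  exists f, W f `<=` [set x | q x = 0] /\ f * inc q = inc p.
Proof.
move=> /non_zero_divisorP dq.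
have [|f [fW fE]] := @ex_quotient [set q] (fun=> p) dq.
  by move=> _ _ -> ->; rewrite mulrC.
by exists f; split; [rewrite coz1 setCK in fW|exact: fE].
Qed.

Lemma non_zero_divisor_inverse q : non_zero_divisor q ->
  exists r : Hnf R X, inc q * r = 1.
Proof.
by move=> /(ex_fraction 1)[r [_ qr]]; exists r; rewrite mulrC qr rmorph1.
Qed.

Lemma Hsz_fractions : [set f : Hnf R X | f \in @Hsz_pred R X] =
  fractions (@inc R X : {rmorphism C -> Hnf R X}).
Proof.
apply/seteqP; split=> [f /asboolP[_ [[z ->] dz fz]]|_ [p [q [r [nq qr ->]]]]].
  have [|p [q [fq qE]]] := ex_denominator fz; first exact: nowhere_denseS dz.
  have nq : non_zero_divisor q.
    apply/non_zero_divisorP/dense_coz_rationally_dense; rewrite coz1.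
    apply/dense_setC/(nowhere_denseS qE)/nowhere_denseU => //.
    by case: (Hnf_nearly_finite f).
  have [r qr] := non_zero_divisor_inverse nq.
  exists p, q, r; split=> //.
  by rewrite -[RHS]/(inc p * r) -fq -mulrA qr mulr1.
have [f [fW fq]] := ex_fraction p nq.
apply/asboolP; exists [set x | q x = 0]; split; first by exists q.
  rewrite -[X in nowhere_dense X]setCK -coz1; apply: nowhere_dense_setC.
    exact: open_coz.
  exact/rationally_dense_coz/non_zero_divisorP.
by rewrite -[X in W X]/(Hnf_fun (inc p * r)) -fq -mulrA [_ * r]qr mulr1.
Qed.

End CompletelyRegular.

Theorem theorem7 (R : realType) (X : topologicalType)
    (crX : completely_regular_space X) :
  (subring_closed (@Hnd_pred R X) /\
   maximal_rational_extension
     (@inc_nd R X : {rmorphism continuousType X R -> Hnd R X}))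
  /\
  [/\ subring_closed (@Hsz_pred R X),
      forall q : continuousType X R, non_zero_divisor q ->
        exists r : Hnf R X, inc q * r = 1
    & [set f : Hnf R X | f \in @Hsz_pred R X] =
      fractions (@inc R X : {rmorphism continuousType X R -> Hnf R X})].
Proof.
have Hsz := Hsz_fractions R crX.
split; first by split; [exact: Hnd_subring|exact: inc_nd_maximal].
split=> //; first exact: fractions_subring_closed Hsz.
exact: non_zero_divisor_inverse.
Qed.
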